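(* Let $G$ be a non-amenable group equipped with an admissible measure $\mu$. There exists $\varepsilon_0>0$, depending on $G$ and $\mu$, such that if the property $\mathsf{TA}_{\varepsilon,r}$ holds for $(G,\mu)$ for some $\varepsilon\in(0,\varepsilon_0)$ and some $r\geqslant 0$, then $G$ is hyperbolic.
   Context: A probability measure $\mu$ on a group $G$ is admissible if it is symmetric ($\mu(g)=\mu(g^{-1})$), has finite support $\mathcal S=\operatorname{supp}\mu=\{g:\mu(g)>0\}$, and $\mathcal S$ generates $G$. Let $\langle\mathcal S\rangle$ be the free monoid on $\mathcal S$ (words, including the empty word), $\ell_\psi$ the length of a word $\psi$, and $\boldsymbol\pi:\langle\mathcal S\rangle\to G$ the evaluation homomorphism. The word norm is $|g|=\min\{\ell_\psi:\boldsymbol\pi(\psi)=g\}$ and the word distance between $x$ and $y$ is $|x^{-1}y|$. For $x,z\in G$, $[x,z]=\{y\in G:|x^{-1}y|+|y^{-1}z|=|x^{-1}z|\}$, and $B_{\leqslant r}(y)$ is the closed ball of radius $r$ centered at $y$ in the word distance. $\mathrm{Pth}(x,z)=\boldsymbol\pi^{-1}(x^{-1}z)$ is the set of paths from $x$ to $z$: a word $\psi=s_1\dots s_n$ in it is the path visiting the vertices $x\boldsymbol\pi(s_1\cdots s_i)$, $0\leqslant i\leqslant n$; this set of vertices is $\mathrm{Im}\,\psi$. The weight of $\psi$ is $\mu_\psi=\prod_{i=1}^n\mu(s_i)$ (and $1$ for the empty word). The Green function is $\mathrm{Gr}_\mu(g)=\sum\{\mu_\psi:\psi\in\boldsymbol\pi^{-1}(g)\}$;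 it is finite for every $g$ when $G$ is non-amenable. $\mathbb P_{x,z}$ is the probability measure on $\mathrm{Pth}(x,z)$ with $\mathbb P_{x,z}\{\psi\}=\mu_\psi/\mathrm{Gr}_\mu(x^{-1}z)$. Property $\mathsf{TA}_{\varepsilon,r}$ (thick Ancona property): for every $x,z\in G$ and every $y\in[x,z]$, $$\mathbb P_{x,z}\{\psi\in\mathrm{Pth}(x,z):B_{\leqslant r}(y)\cap\mathrm{Im}\,\psi\neq\varnothing\}\geqslant 1-\varepsilon .$$ *)

(* Defs.v *)
From HB Require Import structures.
From mathcomp Require Import all_boot all_order all_algebra.
From mathcomp Require Import all_classical all_reals all_analysis.

Set Implicit Arguments.
Unset Strict Implicit.
Unset Printing Implicit Defensive.

Import Order.TTheory GRing.Theory Num.Theory.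
Local Open Scope classical_set_scope.
Local Open Scope ring_scope.

(* Von Neumann's definition for discrete groups: there is a left-invariant
   finitely additive probability measure on all subsets of G. *)
Definition amenable (R : realType) (G : groupType) : Prop :=
  exists m : set G -> R,
    [/\ forall A, 0 <= m A,
        m setT = 1,
        forall A B, A `&` B = set0 -> m (A `|` B) = m A + m B &
        forall g A, m [set (g * a)%g | a in A] = m A].

Section WordMetric.
Variable G : groupType.
Implicit Types (S H : set G) (g x y z : G) (w : seq G).

(* The subgroup generated by S is the whole group. *)
Definition generates S : Prop :=
  forall H, S `<=` H -> H 1%g ->
    (forall x y, H x -> H y -> H (x * y)%g) ->
    (forall x, H x -> H x^-1%g) -> H = setT.

(* The free monoid on S, realised inside the finite sequences over G. *)
Definition words S : set (seq G) := [set w | forall s, s \in w -> S s].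

Definition word_eval w : G := (\prod_(s <- w) s)%g.

Definition fiber S g : set (seq G) := [set w | words S w /\ word_eval w = g].

(* The junk value 0 is taken only when g is not represented by any word;
   this does not occur when S is symmetric and generates G. *)
Definition word_norm S g : nat :=
  xget 0%N [set n | (exists2 w, fiber S g w & size w = n) /\
                    (forall w, fiber S g w -> (n <= size w)%N)].

Definition word_dist S x y : nat := word_norm S (x^-1 * y)%g.

Definition word_interval S x z : set G :=
  [set y | (word_dist S x y + word_dist S y z)%N = word_dist S x z].

Definition word_ball (R : realType) S (r : R) y : set G :=
  [set x | (word_dist S y x)%:R <= r].

Definition word_paths S x z : set (seq G) := fiber S (x^-1 * z)%g.

(* Vertices visited by the path labelled by w and starting at x. *)
Definition visited x w : set G :=
  [set y | exists2 i, (i <= size w)%N & y = (x * word_eval (take i w))%g].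

Definition gromov_product (R : realType) S o x y : R :=
  ((word_dist S o x)%:R + (word_dist S o y)%:R - (word_dist S x y)%:R) / 2.

(* Gromov's delta-hyperbolicity of the word metric defined by S. *)
Definition hyperbolic_metric (R : realType) S (delta : R) : Prop :=
  forall o x y z,
    Num.min (gromov_product R S o x y) (gromov_product R S o y z) - delta
      <= gromov_product R S o x z.

End WordMetric.

(* The group is hyperbolic when its word metric with respect to some (by
   quasi-isometry invariance, equivalently any) finite symmetric generating
   set is hyperbolic. *)
Definition hyperbolic_group (R : realType) (G : groupType) : Prop :=
  exists S : set G,
    [/\ finite_set S, forall s, S s -> S s^-1%g, generates S &
        exists2 delta : R, 0 <= delta & hyperbolic_metric S delta].

Section Measure.
Variables (R : realType) (G : groupType) (mu : G -> R).

Definition msupport : set G := [set g | 0 < mu g].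

Definition admissible : Prop :=
  [/\ (forall g, 0 <= mu g) /\ (\esum_(g in setT) (mu g)%:E)%E = 1%E,
      forall g, mu g = mu g^-1%g,
      finite_set msupport &
      generates msupport].

Definition weight (w : seq G) : R := \prod_(s <- w) mu s.

Definition green (g : G) : \bar R :=
  (\esum_(w in fiber msupport g) (weight w)%:E)%E.

(* [fine] identifies the Green function with a real number; this is
   meaningful only when [green] is finite, e.g. when mu is admissible and G is
   not amenable. *)
Definition path_prob (x z : G) (E : set (seq G)) : \bar R :=
  (\esum_(w in word_paths msupport x z `&` E)
     (weight w / fine (green (x^-1 * z)%g))%:E)%E.

Definition thick_ancona (eps r : R) : Prop :=
  forall x z y : G, word_interval msupport x z y ->
    ((1 - eps)%:E <=
      path_prob x z
        [set w | word_ball msupport r y `&` visited x w !=set0])%E.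

End Measure.

(* Main.v *)
(** The Green function decays exponentially (Kesten): if the return probabilities
    [u n = p_(2n)(1)] do not satisfy [u (n+1) <= lam * u n] for some [lam < 1], then along a
    subsequence the probability measures [p_n ^ 2 / u n] are almost invariant under products
    of two steps, and an ultralimit of them yields an invariant mean.

    Let [m > 0] bound the step probabilities from below and let [eps < m^2/4].  If [y] lies on
    a geodesic from [x] to [z], [y'] on a geodesic from [x] to [z'], and [d(z,z') <= 1], then
    at least half of the weight of the paths from [x] to [z] visits bounded neighbourhoods of
    both [y] and [y'], so that
      [Gr(x,z) <~ Gr(y,y') (Gr(x,y) Gr(y',z) + Gr(x,y') Gr(y,z))].
    Sliding [y'] along its geodesic one finds a point where [Gr(x,y')/Gr(y',z)] is comparable
    to [Gr(x,y)/Gr(y,z)].  There both products are [<~ Gr(x,z)], so [Gr(y,y')] is bounded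
    below and [d(y,y')] is bounded above.  Hence geodesic bigons whose endpoints
    are at distance at most one are uniformly thin.

    Such a space is hyperbolic (Papasoglu): geodesics from a common origin that separate
    diverge exponentially, which bounds the size of the inscribed ball at the point of a
    geodesic triangle which is farthest from the two other sides. *)
Require Import Defs.
From mathcomp Require Import all_boot all_order all_algebra.
From mathcomp Require Import finmap.
From mathcomp Require Import all_classical all_reals all_analysis.
From mathcomp Require Import zify lra.

Set Implicit Arguments.
Unset Strict Implicit.
Unset Printing Implicit Defensive.

Import Order.TTheory GRing.Theory Num.Theory.
Import numFieldNormedType.Exports.
Local Open Scope classical_set_scope.
Local Open Scope ring_scope.

(** * Exponential divergence in graphs with thin bigons *)

Section ThinToHyperbolic.
Local Open Scope nat_scope.
Variables (X : Type) (d : X -> X -> nat).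
Hypothesis dxx : forall x, d x x = 0.
Hypothesis dC : forall x y, d x y = d y x.
Hypothesis dT : forall x y z, d x z <= d x y + d y z.

Definition geod (n : nat) (c : nat -> X) : Prop :=
  forall i j, i <= j <= n -> d (c i) (c j) = j - i.

Definition between (x y z : X) : Prop := d x y + d y z = d x z.

Hypothesis geod_exists : forall x y, exists2 c, geod (d x y) c & c 0 = x /\ c (d x y) = y.

Variable A : nat.
Hypothesis thin : forall x z z' y y', d z z' <= 1 -> between x y z ->
  between x y' z' -> d x y = d x y' -> d y y' <= A.

(** Steps of length zero are allowed, so a path can be padded and [L] acts as an upper bound on its
    length. *)
Definition linked (P : X -> Prop) (L : nat) (x y : X) : Prop :=
  exists c : nat -> X, [/\ c 0 = x, c L = y,
    forall i, i < L -> d (c i) (c i.+1) <= 1 & forall i, i <= L -> P (c i)].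

Lemma linked_cat P L L' x y z :
  linked P L x y -> linked P L' y z -> linked P (L + L') x z.
Proof.
move=> [c [c0 cL cs cP]] [c' [c0' cL' cs' cP']].
exists (fun i => if i <= L then c i else c' (i - L)); split.
- by [].
- case: ifP => h; last by rewrite addKn.
  have E : L' = 0 by lia.
  by move: cL'; rewrite E addn0 cL c0'.
- move=> i iL; case: ifP => h; case: ifP => h'; try lia.
  + by apply: cs; lia.
  + have -> : i = L by lia.
    by rewrite cL -c0' subSnn; apply: cs'; lia.
  + by rewrite subSn; [apply: cs'; lia|lia].
- move=> i iL; case: ifP => h; first exact: cP.
  by apply: cP'; lia.
Qed.

Lemma linked_sym P L x y : linked P L x y -> linked P L y x.
Proof.
move=> [c [c0 cL cs cP]]; exists (fun i => c (L - i)); split.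
- by rewrite subn0.
- by rewrite subnn.
- move=> i iL; rewrite dC; have -> : L - i = (L - i.+1).+1 by lia.
  by apply: cs; lia.
- by move=> i iL; apply: cP; lia.
Qed.

Lemma linked_le P L L' x y : L <= L' -> linked P L x y -> linked P L' x y.
Proof.
move=> LL' [c [c0 cL cs cP]]; exists (fun i => c (minn i L)); split.
- by rewrite min0n.
- by rewrite /= (minn_idPr LL').
- move=> i iL /=; have [iL'|iL'] := ltnP i L.
    by rewrite (minn_idPl iL') cs.
  by rewrite (minn_idPr (leqW iL')) dxx.
- by move=> i iL; apply: cP; lia.
Qed.

Lemma linked_imp (P Q : X -> Prop) L x y : (forall v, P v -> Q v) ->
  linked P L x y -> linked Q L x y.
Proof. by move=> PQ [c [c0 cL cs cP]]; exists c; split=> // i /cP /PQ. Qed.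

Lemma linked_dist P L x y : linked P L x y -> d x y <= L.
Proof.
move=> [c [<- <- cs _]]; elim: L cs => [|L IH] cs; first by rewrite dxx.
have := IH (fun i iL => cs i (ltnW iL)); have := cs L (leqnn _).
by have := dT (c 0) (c L) (c L.+1); lia.
Qed.

Lemma linked_geod (P : X -> Prop) n c i j : geod n c -> i <= j <= n ->
  (forall k, i <= k <= j -> P (c k)) -> linked P (j - i) (c i) (c j).
Proof.
move=> gc ijn cP; exists (fun k => c (i + k)); split.
- by rewrite addn0.
- by rewrite subnKC; [|lia].
- by move=> k kL; rewrite gc; lia.
- by move=> k kL; apply: cP; lia.
Qed.

Lemma geod_between n c i j k : geod n c -> i <= j <= k -> k <= n ->
  between (c i) (c j) (c k).
Proof. by move=> gc ijk kn; rewrite /between !gc; lia. Qed.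

Lemma linked_pair (P : X -> Prop) x y :
  (forall v, between x v y -> P v) -> linked P (d x y) x y.
Proof.
move=> xyP; have [c gc [c0 cn]] := geod_exists x y.
have := @linked_geod P _ c 0 (d x y) gc; rewrite subn0 c0 cn; apply; first lia.
move=> k kn; apply: xyP; rewrite -{1}c0 -{1}cn.
by apply: (geod_between gc); lia.
Qed.

Lemma between_level x y t : t <= d x y -> exists2 u, between x u y & d x u = t.
Proof.
move=> ty; have [c gc [c0 cn]] := geod_exists x y.
exists (c t); last by rewrite -c0 gc; lia.
by rewrite -{1}c0 -{1}cn; apply: (geod_between gc); lia.
Qed.

(** Join [x] by geodesics to the successive vertices of a path that stays at distance at least [t]
    from [x]. Each step of the path moves the point at level [t] by at most [A]; one more [A]
    compares two geodesics to the same last vertex. *)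
Lemma between_linked_level x p q u v t L :
  between x u p -> between x v q -> d x u = t -> d x v = t ->
  linked (fun w => t <= d x w) L p q -> d u v <= A * L.+1.
Proof.
move=> bu bv xu xv [c [c0 cL cs cP]].
elim: L p u bu xu c c0 cL cs cP => [|L IH] p u bu xu c c0 cL cs cP.
  by rewrite muln1; apply: (thin (x := x) (z := p) (z' := q)) => //; rewrite ?xu // -c0 -cL dxx.
have [u1 bu1 xu1] : exists2 u1, between x u1 (c 1) & d x u1 = t.
  by apply: between_level; apply: cP.
have d1 : d u u1 <= A.
  by apply: (thin (x := x) (z := p) (z' := c 1)); rewrite ?xu // -c0; apply: cs.
have d2 : d u1 v <= A * L.+1.
  by apply: (IH (c 1) u1 bu1 xu1 (fun i => c i.+1)) => // i iL; [apply: cs|apply: cP].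
by rewrite mulnS; have := dT u u1 v; lia.
Qed.

Lemma geod_level x n c t : geod n c -> c 0 = x -> t <= n -> d x (c t) = t.
Proof. by move=> gc <- tn; rewrite gc; lia. Qed.

(** If [s + B <= t], a geodesic from [c t] to [c' t] stays at distance at least [s] from [x], and
    [between_linked_level] applies. Otherwise the detour through [c t] and [c' t] is shorter than
    [3 * B]. *)
Lemma fellow_back x n c n' c' s t B : geod n c -> geod n' c' -> c 0 = x -> c' 0 = x ->
  s <= t -> t <= n -> t <= n' -> d (c t) (c' t) <= B ->
  d (c s) (c' s) <= A * B.+1 + 3 * B.
Proof.
move=> gc gc' c0 c0' st tn tn' cB.
have l := geod_level gc c0; have l' := geod_level gc' c0'.
case: (leqP (s + B) t) => sB; last first.
  have := dT (c s) (c t) (c' s); have := dT (c t) (c' t) (c' s).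
  by rewrite (dC (c' t)) gc ?gc'; lia.
have : d (c s) (c' s) <= A * (d (c t) (c' t)).+1.
  apply: (between_linked_level (x := x) (t := s) (p := c t) (q := c' t)).
  - by rewrite -c0; apply: (geod_between gc); lia.
  - by rewrite -c0'; apply: (geod_between gc'); lia.
  - by apply: l; lia.
  - by apply: l'; lia.
  - apply: linked_pair => v; rewrite /between.
    have := dT x v (c t); rewrite l // (dC v); lia.
have : A * (d (c t) (c' t)).+1 <= A * B.+1 by rewrite leq_mul2l; lia.
lia.
Qed.

(** Interval length that forces the excess of [excess_lt] down to at most [D - k]: two intervals of
    the previous length at the ends, and room in the middle to compare an early and a late
    crossing. *)
Fixpoint stretch (D k : nat) : nat :=
  if k is k'.+1 then 2 * stretch D k' + D + A else 0.

(** The bound of [fellow_back] for [B = 2 * A]: geodesics from a common origin that are more than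
    [M] apart at one time stay more than [2 * A] apart afterwards. *)
Let M := A * (2 * A).+1 + 3 * (2 * A).

(* The excess [d (c a) (c' b) - (b - a)] can only decrease when the interval [a, b] grows;
   when it takes the same value on a long interval and on both its extremities, crossing from
   [c] to [c'] early or late gives two geodesics, so [c] and [c'] are close in the middle. *)
Lemma excess_lt x n c n' c' s e D k a : geod n c -> geod n' c' ->
  c 0 = x -> c' 0 = x -> e <= n -> e <= n' ->
  (forall t, s <= t <= e -> 2 * A < d (c t) (c' t) <= D) ->
  s <= a -> a + stretch D k <= e -> d (c a) (c' (a + stretch D k)) + k < stretch D k + D.+1.
Proof.
move=> gc gc' c0 c0' en en' far; elim: k a => [|k IH] a sa ae /=.
  by rewrite !addn0; have := far a; lia.
move: ae => /=; set l := stretch D k; set b := a + _ => be.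
rewrite ltnNge; apply/negP => big.
have l0 := geod_level gc c0; have l0' := geod_level gc' c0'.
have ab : d (c a) (c' b) <= d (c a) (c' (a + l)) + (b - (a + l)).
  by have := dT (c a) (c' (a + l)) (c' b); rewrite (gc' (a + l)); lia.
have ab' : d (c a) (c' b) <= (b - l - a) + d (c (b - l)) (c' b).
  by have := dT (c a) (c (b - l)) (c' b); rewrite gc; lia.
have I1 := IH a sa; have I2 := IH (b - l).
rewrite -/l in I1 I2; have bl : b - l + l = b by lia.
rewrite bl in I2.
have {}I1 := I1 ltac:(lia); have {}I2 := I2 ltac:(lia) ltac:(lia).
(* By [I1] and [I2] the excess on the two end intervals of length [l] is at most [D - k], and by
   [big] it is at least that on [[a, b]]. Hence it has the constant value [h] on all intermediate
   intervals. *)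
pose h := d (c a) (c' b) - (b - a).
have hD : h <= D by rewrite /h; have := dT (c a) (c' a) (c' b);
   have := far a ltac:(lia); rewrite (gc' a); lia.
have hE : d (c a) (c' b) = b - a + h.
  by rewrite /h; have := dT x (c a) (c' b); rewrite l0 ?l0'; lia.
have e1 t : a + l <= t <= b -> d (c a) (c' t) = t - a + h.
  move=> tb; have := dT (c a) (c' (a + l)) (c' t); have := dT (c a) (c' t) (c' b).
  rewrite (gc' (a + l)) ?(gc' t); lia.
have e2 t : a <= t <= b - l -> d (c t) (c' b) = b - t + h.
  move=> tb; have := dT (c t) (c (b - l)) (c' b); have := dT (c a) (c t) (c' b).
  rewrite (gc a) ?(gc t); lia.
(* Both [c t] and [c' (t - h)] lie on geodesics from [c a] to [c' b], at the same distance [t - a]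
   from [c a]. Thinness puts them within [A], so [h <= A], and then [c t] and [c' t] are within
   [2 * A], against [far]. *)
pose t := a + l + D.
have tt : d (c t) (c' (t - h)) <= A.
  apply: (thin (x := c a) (z := c' b) (z' := c' b)).
  - by rewrite dxx.
  - by rewrite /between e2 ?gc ?hE; lia.
  - by rewrite /between e1 ?gc' ?hE; lia.
  - by rewrite e1 ?gc; lia.
have hA : h <= A.
  have := dT x (c' (t - h)) (c t); rewrite l0' ?l0 ?(dC _ (c t)); lia.
have := far t ltac:(lia); have := dT (c t) (c' (t - h)) (c' t).
rewrite gc'; lia.
Qed.

(** Were the distance at most [D] throughout, it would also exceed [2 * A] throughout by
    [fellow_back]. Then [excess_lt] with [k = D + 1] would make the excess negative, against the
    triangle inequality. *)
Lemma diverge D x n c n' c' s : geod n c -> geod n' c' ->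
  c 0 = x -> c' 0 = x -> M < d (c s) (c' s) ->
  s + stretch D D.+1 <= n -> s + stretch D D.+1 <= n' ->
  exists2 i, i <= stretch D D.+1 & D < d (c (s + i)) (c' (s + i)).
Proof.
set r0 := stretch D D.+1.
move=> gc gc' c0 c0' Ms sn sn'; apply: contrapT => no.
have := @excess_lt x n c n' c' s (s + r0) D D.+1 s gc gc' c0 c0' sn sn'.
have l0 := geod_level gc c0; have l0' := geod_level gc' c0'.
have := dT x (c s) (c' (s + r0)); rewrite l0 ?l0' ?/r0 // -?/r0; last by lia.
move=> h H; suff : d (c s) (c' (s + r0)) + D.+1 < r0 + D.+1 by lia.
apply: H => // t ts; apply/andP; split.
  rewrite ltnNge; apply/negP => tA.
  have : d (c s) (c' s) <= M by apply: (fellow_back gc gc' c0 c0' _ _ _ tA); lia.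
  lia.
rewrite leqNgt; apply/negP => tD; apply: no; exists (t - s); first lia.
by rewrite subnKC //; lia.
Qed.

(** Time after which geodesics [M] apart get more than [2 * M + A] apart: a point within [M + A] of
    one is then more than [M] away from the other. *)
Let r0 := stretch (2 * M + A) (2 * M + A).+1.

(** Induction on [k]. Choose a level [s'] in [[s, s + r0]] where [c] and [c'] are far apart, and cut
    the path at its first vertex having a geodesic from [x] more than [M] away from [c] at that
    level. This geodesic is also more than [M] away from [c'], so both parts of the path have length
    at least [2 ^ k]. *)
Lemma exp_divergence k x n c n' c' s L : geod n c -> geod n' c' ->
  c 0 = x -> c' 0 = x -> s <= n -> s <= n' -> M < d (c s) (c' s) ->
  linked (fun w => s + k * r0 <= d x w) L (c n) (c' n') -> 2 ^ k <= L.
Proof.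
elim: k n c n' c' s L => [|k IH] n c n' c' s L gc gc' c0 c0' sn sn' Ms.
  move=> lk; rewrite expn0 lt0n; apply/eqP => L0; move: lk; rewrite L0 => lk.
  have : d (c s) (c' s) <= A * 1.
    apply: (between_linked_level (x := x) (t := s) (p := c n) (q := c' n')).
    - by rewrite -c0; apply: (geod_between gc); lia.
    - by rewrite -c0'; apply: (geod_between gc'); lia.
    - by rewrite (geod_level gc).
    - by rewrite (geod_level gc').
    - by apply: linked_imp lk => v; lia.
  by move: Ms; rewrite /M; lia.
have l0 := geod_level gc c0; have l0' := geod_level gc' c0'.
move=> [w [w0 wL ws wP]].
have sr : s + r0 <= n by have := wP 0 isT; rewrite w0 l0 //; lia.
have sr' : s + r0 <= n' by have := wP L (leqnn _); rewrite wL l0' //; lia.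
have [i ir far] := diverge gc gc' c0 c0' Ms sr sr'.
pose s' := s + i.
have wP' m : m <= L -> s' + k * r0 <= d x (w m).
  by move=> mL; have := wP m mL; rewrite mulSn /s' -/r0 in ir *; lia.
pose Q m := `[< m <= L /\ exists n'' c'', [/\ geod n'' c'', c'' 0 = x, c'' n'' = w m,
   s' <= n'' & M < d (c s') (c'' s')] >].
have exQ : exists m, Q m.
  exists L; apply/asboolP; split => //; exists n', c'; split => //; rewrite /s'; lia.
case: (ex_minnP exQ) => m /asboolP[mL [n2 [c2 [gc2 c02 c2n s'n2 far2]]]] minm.
have m0 : 0 < m.
  rewrite lt0n; apply/eqP => m0.
  suff : d (c s') (c2 s') <= A by move: far2; rewrite /M; lia.
  apply: (thin (x := x) (z := c n) (z' := c2 n2)).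
  - by rewrite c2n m0 w0 dxx.
  - by rewrite -c0; apply: (geod_between gc); rewrite /s'; lia.
  - by rewrite -c02; apply: (geod_between gc2); lia.
  - by rewrite l0 ?(geod_level gc2) // /s'; lia.
(* By minimality of [m], a geodesic to the preceding vertex is within [M] of [c]; passing to the
   next vertex costs [A]. *)
have close : d (c s') (c2 s') <= M + A.
  have [c3 gc3 [c03 c3n]] := geod_exists x (w m.-1).
  have s'n3 : s' <= d x (w m.-1) by have := wP' m.-1; lia.
  have : d (c s') (c3 s') <= M.
    rewrite leqNgt; apply/negP => far3.
    have : Q m.-1 by apply/asboolP; split; [lia|exists (d x (w m.-1)), c3].
    by move/minm; lia.
  have : d (c3 s') (c2 s') <= A.
    apply: (thin (x := x) (z := w m.-1) (z' := w m)).
    - by have := ws m.-1; rewrite prednK //; apply; lia.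
    - by rewrite -c03 -{1}c3n; apply: (geod_between gc3); lia.
    - by rewrite -c02 -c2n; apply: (geod_between gc2); lia.
    - by rewrite (geod_level gc3) ?(geod_level gc2).
  by have := dT (c s') (c3 s') (c2 s'); lia.
have far2' : M < d (c2 s') (c' s').
  by have := dT (c s') (c2 s') (c' s'); rewrite -/s' in far; lia.
have h1 : 2 ^ k <= m.
  apply: (IH n c n2 c2 s') => //; first by rewrite /s'; lia.
  exists w; split => // j jm; first by apply: ws; lia.
  by apply: wP'; lia.
have h2 : 2 ^ k <= L - m.
  apply: (IH n2 c2 n' c' s') => //; first by rewrite /s'; lia.
  exists (fun j => w (m + j)); split.
  - by rewrite addn0 c2n.
  - by rewrite subnKC.
  - by move=> j jm; rewrite addnS; apply: ws; lia.
  - by move=> j jm; apply: wP'; lia.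
by rewrite expnS; lia.
Qed.

(** Follow [c] back towards [o] over a length [7 * D], cross to [c'], and return along [c'].
    Exponential divergence makes the crossing shorter than [M], since [c a] and [c' b] are joined by
    a path of length at most [6 * D < 2 ^ k]. *)
Lemma linked_sides x D k o n c n' c' a b : geod n c -> geod n' c' -> c 0 = o -> c' 0 = o ->
  k * r0 <= D -> 6 * D < 2 ^ k ->
  (forall j, j <= n -> D <= d x (c j)) -> (forall j, j <= n' -> D <= d x (c' j)) ->
  a <= n -> b <= n' -> d (c a) (c' b) <= 6 * D ->
  linked (fun w => D <= d x w + M) (20 * D + M) (c a) (c' b).
Proof.
move=> gc gc' c0 c0' kD kD' xc xc' an bn ab.
have l0 := geod_level gc c0; have l0' := geod_level gc' c0'.
have := dT o (c a) (c' b); have := dT o (c' b) (c a).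
rewrite (dC (c' b)) l0 // l0' // => lab lba.
have seg s i : s <= i <= n -> linked (fun w => D <= d x w + M) (i - s) (c s) (c i).
  by move=> si; apply: (linked_geod gc) => // j ji; have := xc j; lia.
have seg' s i : s <= i <= n' -> linked (fun w => D <= d x w + M) (i - s) (c' s) (c' i).
  by move=> si; apply: (linked_geod gc') => // j ji; have := xc' j; lia.
have [aD|aD] := ltnP a (7 * D).
  apply: (linked_le (L := (a - 0) + (b - 0))); first lia.
  apply: (linked_cat (y := o)).
  - by rewrite -c0; apply: linked_sym; apply: seg; lia.
  - by rewrite -c0'; apply: seg'; lia.
(* A geodesic from [c a] to [c' b] has length at most [6 * D], so it stays at distance at least
   [s + D >= s + k * r0] from [o]. *)
pose s := a - 7 * D; have sE : s = a - 7 * D by [].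
have Ms : d (c s) (c' s) <= M.
  rewrite leqNgt; apply/negP => Ms.
  suff : 2 ^ k <= d (c a) (c' b) by lia.
  apply: (exp_divergence (x := o) (n := a) (c := c) (n' := b) (c' := c') (s := s)) => //.
  - by move=> i j ij; apply: gc; lia.
  - by move=> i j ij; apply: gc'; lia.
  - by lia.
  - by lia.
  - apply: linked_pair => v; rewrite /between.
    have := dT o v (c a); rewrite l0 // (dC v); lia.
apply: (linked_le (L := (a - s) + d (c s) (c' s) + (b - s))).
  lia.
apply: (linked_cat (y := c' s)); last by apply: seg'; lia.
apply: (linked_cat (y := c s)).
  by apply: linked_sym; apply: seg; lia.
apply: linked_pair => v; rewrite /between.
have := dT x v (c s); have := xc s; rewrite (dC v); lia.
Qed.

(** * Thin triangles and the four-point condition *)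

Lemma exp_dominates q e N : exists D0, forall D, D0 <= D ->
  exists k, k * q + e <= D /\ N * D + e < 2 ^ k.
Proof.
pose K := N * (e + 2 * q.+1) + e.
exists (e + 2 * q.+1 * K) => D KD.
(* The witness is [k = 2 * j], with [j] proportional to [D]: then [2 ^ k] is at least the square of
   [j + 1], which beats every linear function of [D]. *)
pose j := (D - e) %/ (2 * q.+1).
have j1 : K <= j by rewrite /j leq_divRL // mulnC; lia.
have j2 : D - e < j.+1 * (2 * q.+1) by rewrite ltn_ceil.
have j3 : j * (2 * q.+1) <= D - e by rewrite leq_trunc_div.
exists (2 * j); split; first by nia.
have h : j.+1 * j.+1 <= 2 ^ (2 * j).
  by rewrite mul2n -addnn expnD; apply: leq_mul; rewrite ltn_expl.
apply: leq_trans h; have : D <= e + j.+1 * (2 * q.+1) by lia.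
move: j1; rewrite /K; nia.
Qed.

(* Through a point of [c] at maximal distance [D] from the two other sides, there is a detour
   avoiding a ball of radius almost [D] whose length is linear in [D]. *)
Lemma thin_triangle : exists D0, forall na a nb b n c,
  geod na a -> geod nb b -> geod n c -> a 0 = b 0 -> c 0 = a na -> c n = b nb ->
  forall i, i <= n ->
  (exists2 j, j <= na & d (c i) (a j) <= D0) \/ (exists2 j, j <= nb & d (c i) (b j) <= D0).
Proof.
(* The detour will have length [22 * D + M] and stay at distance [D - M] from the centre; this
   distance must be at least [M + 1 + k * r0]. *)
have [D0 HD0] := exp_dominates r0 (2 * M + 1) 22.
exists D0 => na a nb b n c ga gb gc ab0 c0 cn i i_n; apply: contrapT => no.
pose side v := (exists2 j, j <= na & v = a j) \/ (exists2 j, j <= nb & v = b j).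
pose far D := `[< exists2 i, i <= n & forall v, side v -> D <= d (c i) v >].
have far0 : far D0.+1.
  apply/asboolP; exists i => // v [[j jn ->]|[j jn ->]]; rewrite ltnNge; apply/negP => jD;
    apply: no; by [left; exists j|right; exists j].
have farB D : far D -> D <= n.
  move=> /asboolP[m mn /(_ (c 0))]; rewrite dC gc; last by lia.
  have sc0 : side (c 0) by left; exists na.
  by move=> /(_ sc0); lia.
have exfar : exists D, far D by exists D0.+1.
case: (ex_maxnP exfar farB) => {farB no i i_n}- D /asboolP[i i_n fari] maxD.
have DD0 : D0 <= D by rewrite ltnW // maxD.
have near m : m <= n -> exists2 v, side v & d (c m) v <= D.
  move=> mn; apply: contrapT => no.
  have : far D.+1.
    apply/asboolP; exists m => // v sv; rewrite ltnNge; apply/negP => vD.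
    by apply: no; exists v.
  by move/maxD; lia.
have [k [kD kD2]] := HD0 D DD0.
(* Move [2 * D] along [c], then go to a side vertex within [D], which exists by maximality of [D];
   this keeps at distance [D] from [c i]. If [c] ends earlier, its endpoint already lies on a
   side. *)
have left_end : exists i1 u, [/\ i1 <= i, D <= i - i1 <= 2 * D, side u &
    linked (fun w => D <= d (c i) w) D (c i1) u].
  have s0 : side (c 0) by left; exists na.
  have [iD|iD] := ltnP i (2 * D).
    exists 0, (c 0); split => //.
      by have := fari _ s0; rewrite dC gc //; lia.
    apply: (linked_le (L := 0)) => //; exists (fun _ => c 0); split => // *.
    exact: fari.
  have [v sv vD] := near (i - 2 * D) ltac:(lia).
  exists (i - 2 * D), v; split => //; try lia.
  apply: (linked_le vD); apply: linked_pair => w; rewrite /between => wb.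
  have := dT (c i) w (c (i - 2 * D)).
  by rewrite (dC (c i) (c _)) gc ?(dC w); lia.
have right_end : exists i2 u, [/\ i <= i2 <= n, D <= i2 - i <= 2 * D, side u &
    linked (fun w => D <= d (c i) w) D (c i2) u].
  have s0 : side (c n) by right; exists nb.
  have [iD|iD] := ltnP n (i + 2 * D).
    exists n, (c n); split => //; try lia.
      by have := fari _ s0; rewrite gc //; lia.
    apply: (linked_le (L := 0)) => //; exists (fun _ => c n); split => // *.
    exact: fari.
  have [v sv vD] := near (i + 2 * D) ltac:(lia).
  exists (i + 2 * D), v; split => //; try lia.
  apply: (linked_le vD); apply: linked_pair => w; rewrite /between => wb.
  have := dT (c i) w (c (i + 2 * D)).
  by rewrite gc ?(dC w); lia.
have [i1 [u [i1i i1D su lu]]] := left_end.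
have [i2 [v [i2i i2D sv lv]]] := right_end.
have du : d (c i1) u <= D := linked_dist lu.
have dv : d (c i2) v <= D := linked_dist lv.
have uv : d u v <= 6 * D.
  have := dT u (c i1) v; have := dT (c i1) (c i2) v; rewrite (dC u (c i1)) gc; lia.
have fa j : j <= na -> D <= d (c i) (a j) by move=> jn; apply: fari; left; exists j.
have fb j : j <= nb -> D <= d (c i) (b j) by move=> jn; apply: fari; right; exists j.
have luv : linked (fun w => D <= d (c i) w + M) (20 * D + M) u v.
  case: su sv uv => [[j1 j1n ->]|[j1 j1n ->]] [[j2 j2n ->]|[j2 j2n ->]] uv.
  - by apply: (linked_sides (k := k) (o := a 0) ga ga) => //; lia.
  - by apply: (linked_sides (k := k) (o := a 0) ga gb) => //; lia.
  - by apply: (linked_sides (k := k) (o := a 0) gb ga) => //; lia.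
  - by apply: (linked_sides (k := k) (o := a 0) gb gb) => //; lia.
have lk : linked (fun w => M.+1 + k * r0 <= d (c i) w) (D + (20 * D + M) + D) (c i1) (c i2).
  apply: linked_cat; last by apply: linked_sym; apply: linked_imp lv => w; lia.
  apply: linked_cat; first by apply: linked_imp lu => w; lia.
  by apply: linked_imp luv => w; lia.
suff : 2 ^ k <= D + (20 * D + M) + D by lia.
(* The two halves of [c] issuing from [c i] are geodesics, at distance [2 * (M + 1) > M] from each
   other at level [M + 1]. *)
apply: (exp_divergence (x := c i) (n := i - i1) (c := fun j => c (i - j)) (n' := i2 - i)
   (c' := fun j => c (i + j)) (s := M.+1)).
- by move=> j1 j2 j12; rewrite dC gc; lia.
- by move=> j1 j2 j12; rewrite gc; lia.
- by rewrite subn0.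
- by rewrite addn0.
- lia.
- lia.
- by rewrite gc; lia.
- by rewrite subKn // subnKC; last lia.
Qed.

(** Some point of [[x, z]] is close to both [[o, x]] and [[o, z]], and it is also close to [[y, x]]
    or [[y, z]]. Routing [o] to [y] and [x] to [z] through it gives the inequality. *)
Lemma thin_four_point : exists delta, forall o x y z,
  d o y + d x z <= maxn (d o z + d x y) (d o x + d y z) + delta.
Proof.
have [D HD] := thin_triangle; exists (4 * D + 4) => o x y z.
have [c gc [c0 cn]] := geod_exists x z.
have [a ga [a0 an]] := geod_exists o x; have [b gb [b0 bn]] := geod_exists o z.
have [a' ga' [a0' an']] := geod_exists y x; have [b' gb' [b0' bn']] := geod_exists y z.
have tri := HD _ _ _ _ _ _ ga gb gc ltac:(congruence) ltac:(congruence) ltac:(congruence).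
have tri' := HD _ _ _ _ _ _ ga' gb' gc ltac:(congruence) ltac:(congruence) ltac:(congruence).
have dist u v n e j : geod n e -> e 0 = u -> e n = v -> n = d u v -> j <= n ->
    d u (e j) + d (e j) v = d u v.
  by move=> ge <- <- nE jn; apply: (geod_between ge); lia.
(* Take the first vertex of [c] that is close to [[o, z]]. Its predecessor is close to [[o, x]],
   whence the bound [D.+1]. *)
have [i i_n [[j jn ij] [j' jn' ij']]] : exists2 i, i <= d x z &
    (exists2 j, j <= d o x & d (c i) (a j) <= D.+1) /\
    (exists2 j, j <= d o z & d (c i) (b j) <= D.+1).
  pose Q i := `[< exists2 j, j <= d o z & d (c i) (b j) <= D >].
  have exQ : exists i, Q i.
    by exists (d x z); apply/asboolP; exists (d o z) => //; rewrite cn bn dxx.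
  case: (ex_minnP exQ) => i /asboolP[j jn ij] mini.
  have i_n : i <= d x z by apply: mini; apply/asboolP; exists (d o z) => //; rewrite cn bn dxx.
  exists i => //; split; last by exists j => //; lia.
  case: i ij mini i_n => [|i] ij mini i_n.
    by exists (d o x) => //; rewrite c0 an dxx.
  case: (tri i (ltnW i_n)) => [[j1 j1n ij1]|nb].
    exists j1 => //; have := dT (c i.+1) (c i) (a j1).
    by rewrite (dC (c i.+1) (c i)) gc; lia.
  have : Q i by apply/asboolP.
  by move/mini; rewrite ltnn.
have h1 := dist _ _ _ _ _ ga a0 an erefl jn.
have h2 := dist _ _ _ _ _ gb b0 bn erefl jn'.
have h3 := dist _ _ _ _ _ gc c0 cn erefl i_n.
have k1 := dT o (a j) (c i); have k2 := dT (c i) (a j) x.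
have k3 := dT o (b j') (c i); have k4 := dT (c i) (b j') z.
rewrite (dC (a j) (c i)) in k1; rewrite (dC (b j') (c i)) in k3.
have k5 := dT o (c i) y; rewrite (dC (c i) y) in k5.
rewrite (dC x (c i)) in h3.
case: (tri' i i_n) => [[l ln il]|[l ln il]].
- have h4 := dist _ _ _ _ _ ga' a0' an' erefl ln.
  have k6 := dT y (a' l) (c i); have k7 := dT (c i) (a' l) x.
  rewrite (dC (a' l) (c i)) in k6; rewrite (dC x y); lia.
- have h4 := dist _ _ _ _ _ gb' b0' bn' erefl ln.
  have k6 := dT y (b' l) (c i); have k7 := dT (c i) (b' l) z.
  rewrite (dC (b' l) (c i)) in k6; lia.
Qed.

End ThinToHyperbolic.

(** * Sums over sets of words *)

Section Esum.
Variable R : realType.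
Implicit Types T : choiceType.
Local Open Scope ereal_scope.

Lemma subset_esum T (A B : set T) (a : T -> \bar R) : (forall x, 0 <= a x) ->
  A `<=` B -> \esum_(x in A) a x <= \esum_(x in B) a x.
Proof.
move=> a0 AB; apply: ge_ereal_sup => _ [X [finX XA] <-].
by apply: ereal_sup_ubound; exists X => //; split=> // x /XA /AB.
Qed.

Lemma esum_inj_le T T' (A : set T) (B : set T') (f : T -> T') a (b : T' -> \bar R) :
  set_inj A f -> (forall x, A x -> B (f x)) -> (forall x, A x -> a x <= b (f x)) ->
  (forall y, 0 <= b y) -> \esum_(x in A) a x <= \esum_(y in B) b y.
Proof.
move=> injf AB ab b0; apply: le_trans (le_esum ab) _.
rewrite -(esum_image A f b injf); apply: subset_esum => // _ [x Ax <-]; exact: AB.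
Qed.

Lemma esum_supp T (A : set T) (a : T -> \bar R) : (forall x, ~ A x -> a x = 0) ->
  \esum_(x in [set: T]) a x = \esum_(x in A) a x.
Proof.
move=> a0; rewrite [RHS]esum_mkcond; apply: eq_esum => x _.
by case: ifPn => //; rewrite notin_setE => /a0.
Qed.

Lemma esumZl T (A : set T) (c : R) (a : T -> R) : (0 <= c)%R -> (forall x, 0 <= a x)%R ->
  \esum_(x in A) (c * a x)%:E = c%:E * \esum_(x in A) (a x)%:E.
Proof.
move=> c0 a0; rewrite /esum -ereal_supZl //; last first.
  by apply/set0P; exists 0; exists set0; [exact: fsets_set0|rewrite fsbig_set0].
congr ereal_sup; rewrite image_comp; apply: eq_imagel => X [finX _] /=.
by rewrite ge0_mule_fsumr.
Qed.

Lemma esum_seq_bigcup_le T (I : eqType) (r : seq I) (A : set T) (B : I -> set T)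
    (a : T -> \bar R) : (forall x, 0 <= a x) ->
  (forall x, A x -> exists2 i, i \in r & B i x) ->
  \esum_(x in A) a x <= \sum_(i <- r) \esum_(x in B i) a x.
Proof.
move=> a0; elim: r A => [|i r IH] A AB.
  by rewrite big_nil esum1 // => x /AB[].
rewrite big_cons (esumID (B i)) //; apply: leeD.
  by apply: subset_esum => // x [].
apply: IH => x [/AB[j]]; rewrite inE => /orP[/eqP -> //|jr Bj _].
by exists j.
Qed.

Lemma esum_mul T T' (A : set T) (B : set T') (a : T -> R) (b : T' -> R) :
  (forall x, 0 <= a x)%R -> (forall x, 0 <= b x)%R ->
  \esum_(x in B) (b x)%:E \is a fin_num ->
  \esum_(x in A `*` B) (a x.1 * b x.2)%:E =
    (\esum_(x in A) (a x)%:E) * \esum_(x in B) (b x)%:E.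
Proof.
move=> a0 b0 bfin.
rewrite -(@esum_esum R T T' A (fun _ => B) (fun x y => (a x * b y)%:E)); last first.
  by move=> i j _ _; rewrite lee_fin mulr_ge0.
under eq_esum do rewrite esumZl //.
have B0 : 0 <= \esum_(x in B) (b x)%:E by apply: esum_ge0 => x _; rewrite lee_fin.
rewrite -(fineK bfin) [RHS]muleC -esumZl ?fine_ge0 //.
by apply: eq_esum => x _; rewrite -EFinM mulrC.
Qed.

End Esum.

(** * Words, their evaluation and their inverses *)

Section Words.
Variable G : groupType.
Implicit Types (S : set G) (g h : G) (v w : seq G).

Lemma word_eval_cat v w : word_eval (v ++ w) = (word_eval v * word_eval w)%g.
Proof. exact: big_cat. Qed.

Lemma word_eval_cons g w : word_eval (g :: w) = (g * word_eval w)%g.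
Proof. exact: big_cons. Qed.

Lemma word_eval_nil : word_eval [::] = 1%g :> G.
Proof. exact: big_nil. Qed.

Lemma words_cat S v w : words S (v ++ w) <-> words S v /\ words S w.
Proof.
split=> [H|[Hv Hw] s]; last by rewrite mem_cat => /orP[/Hv|/Hw].
by split=> s sw; apply: H; rewrite mem_cat sw ?orbT.
Qed.

Lemma words_cons S g w : words S (g :: w) <-> S g /\ words S w.
Proof.
split=> [H|[Hg Hw] s]; last by rewrite inE => /orP[/eqP->|/Hw].
by split=> [|s sw]; apply: H; rewrite inE ?eqxx ?sw ?orbT.
Qed.

Lemma words_take S i w : words S w -> words S (take i w).
Proof. by rewrite -{1}(cat_take_drop i w) => /words_cat[]. Qed.

Lemma words_drop S i w : words S w -> words S (drop i w).
Proof. by rewrite -{1}(cat_take_drop i w) => /words_cat[]. Qed.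

Lemma fiber_cat S g h v w : fiber S g v -> fiber S h w -> fiber S (g * h)%g (v ++ w).
Proof. by move=> [Sv <-] [Sw <-]; split; [apply/words_cat|rewrite word_eval_cat]. Qed.

Lemma fiber_nil S : fiber S 1%g [::].
Proof. by split=> //; exact: word_eval_nil. Qed.

Definition word_inv w : seq G := map (fun s => s^-1%g) (rev w).

Lemma word_invK : involutive word_inv.
Proof.
by move=> w; rewrite /word_inv -map_rev revK -map_comp map_id_in // => s _ /=; rewrite invgK.
Qed.

Lemma size_word_inv w : size (word_inv w) = size w.
Proof. by rewrite size_map size_rev. Qed.

Lemma fiber_inv S g w : (forall s, S s -> S s^-1%g) -> fiber S g w -> fiber S g^-1%g (word_inv w).
Proof.
move=> Sinv [Sw <-]; split.
  by move=> s /mapP[t]; rewrite mem_rev => /Sw/Sinv St ->.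
by rewrite /word_eval big_map prodgV revK.
Qed.

End Words.

(** * The word metric of a symmetric generating set *)

Section WordMetric.
Variables (G : groupType) (S : set G).
Hypotheses (Sinv : forall s, S s -> S s^-1%g) (genS : generates S).
Implicit Types x y z g h : G.

Local Notation d := (word_dist S).

(** The elements represented by words form a subgroup containing [S]. *)
Lemma fiber_ex g : exists w, fiber S g w.
Proof.
suff H : [set g | exists w, fiber S g w] = setT by have : [set: G] g by []; rewrite -H.
apply: genS.
- move=> s Ss; exists [:: s]; split; first by apply/words_cons; split.
  by rewrite word_eval_cons word_eval_nil mulg1.
- by exists [::]; exact: fiber_nil.
- by move=> x y [v Hv] [w Hw]; exists (v ++ w); exact: fiber_cat.
- by move=> x [w Hw]; exists (word_inv w); exact: fiber_inv.
Qed.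

Lemma word_normP g : (exists2 w, fiber S g w & size w = word_norm S g) /\
  (forall w, fiber S g w -> (word_norm S g <= size w)%N).
Proof.
rewrite /word_norm; set P := (X in xget _ X); suff : P (xget 0%N P) by [].
apply: xgetPex; have [w0 Hw0] := fiber_ex g.
have ex : exists n, `[< exists2 w, fiber S g w & size w = n >].
  by exists (size w0); apply/asboolP; exists w0.
case: (ex_minnP ex) => n /asboolP nP nmin; exists n; split=> // w Hw.
by apply: nmin; apply/asboolP; exists w.
Qed.

Lemma word_norm_le g w : fiber S g w -> (word_norm S g <= size w)%N.
Proof. by case: (word_normP g) => _; apply. Qed.

Lemma word_norm_ex g : exists2 w, fiber S g w & size w = word_norm S g.
Proof. by case: (word_normP g). Qed.

Lemma word_norm1 : word_norm S 1%g = 0%N.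
Proof. by apply/eqP; rewrite -leqn0 (word_norm_le (fiber_nil S)). Qed.

Lemma word_normM g h : (word_norm S (g * h)%g <= word_norm S g + word_norm S h)%N.
Proof.
have [v Hv <-] := word_norm_ex g; have [w Hw <-] := word_norm_ex h.
by rewrite -size_cat; apply/word_norm_le/fiber_cat.
Qed.

Lemma word_normV g : word_norm S g^-1%g = word_norm S g.
Proof.
suff H h : (word_norm S h^-1%g <= word_norm S h)%N.
  by apply/eqP; rewrite eqn_leq H -{1}(invgK g) H.
have [v Hv <-] := word_norm_ex h.
by rewrite -size_word_inv; apply/word_norm_le/fiber_inv.
Qed.

Lemma word_dist_xx x : d x x = 0%N.
Proof. by rewrite /word_dist mulVg word_norm1. Qed.

Lemma word_distC x y : d x y = d y x.
Proof. by rewrite /word_dist -word_normV invgM invgK. Qed.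

Lemma word_distT x y z : (d x z <= d x y + d y z)%N.
Proof.
have E : (x^-1 * z = (x^-1 * y) * (y^-1 * z))%g by rewrite mulgA mulgK.
by rewrite /word_dist E word_normM.
Qed.

Lemma word_path_dist x w i j : words S w -> (i <= j <= size w)%N ->
  (d (x * word_eval (take i w)) (x * word_eval (take j w)) <= j - i)%N.
Proof.
move=> Sw /andP[ij jw].
have tj : take j w = take i w ++ take (j - i) (drop i w).
  by rewrite -takeD subnKC.
rewrite /word_dist tj word_eval_cat invgM -!mulgA mulKg mulKg.
apply: (leq_trans (word_norm_le (w := take (j - i) (drop i w)) _)).
  by split=> //; apply: words_take; apply: words_drop.
by rewrite size_take_min geq_minl.
Qed.

Lemma word_path_geod x w i j : words S w -> size w = d x (x * word_eval w)%g ->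
  (i <= j <= size w)%N ->
  d (x * word_eval (take i w)) (x * word_eval (take j w)) = (j - i)%N.
Proof.
move=> Sw wd ij; have h k l := @word_path_dist x w k l Sw.
apply/eqP; rewrite eqn_leq h //=.
have h1 := h 0%N i ltac:(lia); have h2 := h j (size w) ltac:(lia).
rewrite take0 word_eval_nil mulg1 subn0 in h1; rewrite take_size in h2.
have := word_distT x (x * word_eval (take i w)) (x * word_eval w).
have := word_distT (x * word_eval (take i w)) (x * word_eval (take j w)) (x * word_eval w).
lia.
Qed.

End WordMetric.

(** * Return probabilities and amenability *)

Section Walk.
Variables (R : realType) (G : groupType) (mu : G -> R).
Hypothesis adm : admissible mu.
Implicit Types g h s t : G.

Local Notation S := (msupport mu).
Local Notation steps := (fset_set (msupport mu)).

Let mu0 g : 0 <= mu g. Proof. by case: adm => -[m0 _] _ _ _; exact: m0. Qed.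
Let muV g : mu g^-1%g = mu g. Proof. by case: adm => _ h _ _; rewrite [RHS]h. Qed.
Let finS : finite_set S. Proof. by case: adm. Qed.

Lemma mem_steps s : (s \in steps) = (s \in S).
Proof. by rewrite in_fset_set. Qed.

Lemma stepsP s : reflect (0 < mu s) (s \in steps).
Proof. by rewrite mem_steps; apply: (iffP idP); rewrite inE. Qed.

Lemma sum_steps : \sum_(s <- steps) mu s = 1.
Proof.
apply: EFin_inj; case: adm => -[_ <- _ _ _].
rewrite (@esum_supp _ _ S) => [|x /negP].
  rewrite esum_fset ?fsbig_finite ?sumEFin // => i _.
  by rewrite lee_fin.
by rewrite -leNgt => x0; congr EFin; apply/eqP; rewrite eq_le x0 mu0.
Qed.

Lemma sum_stepsV (F : G -> R) : \sum_(s <- steps) F s^-1%g = \sum_(s <- steps) F s.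
Proof.
rewrite -(big_map (fun s => s^-1%g) xpredT F); apply: perm_big; apply: uniq_perm.
- by rewrite map_inj_uniq ?fset_uniq //; exact: invg_inj.
- exact: fset_uniq.
- move=> s; apply/mapP/idP => [[x /stepsP x0 ->]|/stepsP s0].
    by apply/stepsP; rewrite muV.
  by exists s^-1%g; rewrite ?invgK //; apply/stepsP; rewrite muV.
Qed.

(** The [n]-fold convolution power of [mu]: the law at time [n] of the random walk started at the
    identity. *)
Fixpoint walk n g : R :=
  if n is n'.+1 then \sum_(s <- steps) mu s * walk n' (s^-1 * g)%g else (g == 1%g)%:R.

Lemma walk_ge0 n g : 0 <= walk n g.
Proof. by elim: n g => [|n IH] g /=; rewrite ?ler0n // sumr_ge0 // => s _; rewrite mulr_ge0. Qed.

Lemma walkSr n g : walk n.+1 g = \sum_(s <- steps) mu s * walk n (g * s^-1)%g.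
Proof.
elim: n g => [|n IH] g.
  apply: eq_bigr => s _; congr (_ * (nat_of_bool _)%:R).
  by apply/eqP/eqP => /mulg1_eq <-; rewrite mulVg.
transitivity (\sum_(s <- steps) mu s * walk n.+1 (s^-1 * g)%g) => //.
under eq_bigr do rewrite IH mulr_sumr.
rewrite exchange_big /=; apply: eq_bigr => s _; rewrite mulr_sumr.
by apply: eq_bigr => t _; rewrite mulrCA mulgA.
Qed.

Lemma walkV n g : walk n g^-1%g = walk n g.
Proof.
elim: n g => [|n IH] g; first by rewrite /= invg_eq1.
rewrite [RHS]walkSr /= -sum_stepsV; apply: eq_bigr => s _.
by rewrite muV invgK -IH invgM !invgK.
Qed.

Lemma walk_convolution m n h :
  (\esum_(g in [set: G]) (walk m g * walk n (g^-1 * h)%g)%:E)%E = (walk (m + n) h)%:E.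
Proof.
elim: m h => [|m IH] h.
  rewrite (@esum_supp _ _ [set 1%g]); last first.
    by move=> g /eqP/negPf g1; rewrite /= g1 mul0r.
  by rewrite esum_set1 /= ?eqxx ?mul1r ?invg1 ?mul1g // lee_fin walk_ge0.
have step s g : (mu s * (walk m (s^-1 * g)%g * walk n (g^-1 * h)%g) >= 0).
  by rewrite !mulr_ge0 ?walk_ge0.
transitivity (\esum_(g in [set: G]) \sum_(s <- steps)
   (mu s * (walk m (s^-1 * g)%g * walk n (g^-1 * h)%g))%:E)%E.
  by apply: eq_esum => g _; rewrite sumEFin /= mulr_suml; under [in RHS]eq_bigr do rewrite mulrA.
rewrite esum_sum; last by move=> g s _ _; rewrite lee_fin.
rewrite addSn /= -sumEFin; apply: eq_bigr => s _.
rewrite esumZl //; last by move=> g; rewrite mulr_ge0 ?walk_ge0.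
rewrite EFinM; congr (_ * _)%E; rewrite -IH.
rewrite (reindex_esum setT setT (fun g => s * g)%g); last first.
  split=> // [g1 g2 _ _|g _]; first exact: mulgI.
  by exists (s^-1 * g)%g; rewrite ?mulKVg ?mulVKg.
by apply: eq_esum => g _; rewrite mulKg invgM mulgA.
Qed.

Lemma esum_walk_sqr n t :
  (\esum_(g in [set: G]) (walk n (t^-1 * g)%g ^+ 2)%:E)%E = (walk (n + n) 1%g)%:E.
Proof.
rewrite -walk_convolution (reindex_esum setT setT (fun g => t * g)%g); last first.
  split=> // [g1 g2 _ _|g _]; first exact: mulgI.
  by exists (t^-1 * g)%g; rewrite ?mulVKg.
by apply: eq_esum => g _; rewrite mulKg mulg1 walkV expr2.
Qed.

(** Expand the square: by symmetry each square term sums to the return probability at time [2n], and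
    the cross term is a convolution. *)
Lemma esum_walk_diff n t :
  (\esum_(g in [set: G]) ((walk n g - walk n (t^-1 * g)%g) ^+ 2)%:E)%E
    = (2 * (walk (n + n) 1%g - walk (n + n) t))%:E.
Proof.
(* The cross term is kept on the left, which avoids subtraction of extended reals. *)
have H : (\esum_(g in [set: G]) ((walk n g - walk n (t^-1 * g)%g) ^+ 2)%:E + 
   2%:E * \esum_(g in [set: G]) (walk n g * walk n (g^-1 * t)%g)%:E)%E
   = (2 * walk (n + n) 1%g)%:E.
  rewrite -esumZl // => [|g]; last by rewrite mulr_ge0 ?walk_ge0.
  rewrite -esumD => [|g _|g _]; rewrite ?lee_fin ?sqr_ge0 ?mulr_ge0 ?walk_ge0 //.
  have -> : (2 * walk (n + n) 1%g)%:E = (\esum_(g in [set: G]) (walk n (1^-1 * g)%g ^+ 2)%:E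
     + \esum_(g in [set: G]) (walk n (t^-1 * g)%g ^+ 2)%:E)%E.
    by rewrite !esum_walk_sqr -EFinD; congr EFin; lra.
  rewrite -esumD => [|g _|g _]; rewrite ?lee_fin ?sqr_ge0 //.
  apply: eq_esum => g _; rewrite -!EFinD invg1 mul1g; congr EFin.
  by rewrite -(walkV _ (g^-1 * t)%g) invgM invgK; lra.
move: H; rewrite walk_convolution; case: (esum _ _) => //= r [] rE.
by congr EFin; lra.
Qed.

Lemma walk_le1 n t : walk (n + n) t <= walk (n + n) 1%g.
Proof.
have : (0 <= \esum_(g in [set: G]) ((walk n g - walk n (t^-1 * g)%g) ^+ 2)%:E)%E.
  by apply: esum_ge0 => g _; rewrite lee_fin sqr_ge0.
by rewrite esum_walk_diff lee_fin; lra.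
Qed.

Lemma steps_ex : exists s, s \in steps.
Proof.
have := sum_steps; case: (fset_set S) => -[|s l] /= u.
  by rewrite big_nil => /esym/eqP; rewrite oner_eq0.
by exists s; rewrite inE eqxx.
Qed.

Lemma walkS_ge n s g : s \in steps -> mu s * walk n (s^-1 * g)%g <= walk n.+1 g.
Proof.
move=> sS /=; rewrite (big_fsetD1 s) //= lerDl sumr_ge0 // => i _.
by rewrite mulr_ge0 ?walk_ge0.
Qed.

Lemma walk_even_gt0 n : 0 < walk (n + n) 1%g.
Proof.
have [s sS] := steps_ex; have s0 := stepsP _ sS.
elim: n => [|n IH]; first by rewrite /= eqxx.
rewrite addSn addnS; have sV : s^-1%g \in steps by apply/stepsP; rewrite muV.
apply: lt_le_trans (walkS_ge _ _ sS); rewrite mulr_gt0 // mulg1.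
apply: lt_le_trans (walkS_ge _ _ sV); rewrite mulr_gt0 ?muV // invgK mulgV.
exact: IH.
Qed.

(** The right-hand side is the average over two steps [s], [t] of
    [walk (n + n) 1 - walk (n + n) (s * t)]. All these terms are nonnegative by [walk_le1], so a
    single one can be kept. *)
Lemma walk_even_drop n s1 s2 : s1 \in steps -> s2 \in steps ->
  mu s1 * mu s2 * (walk (n + n) 1%g - walk (n + n) (s1 * s2)%g)
    <= walk (n + n) 1%g - walk (n.+1 + n.+1) 1%g.
Proof.
move=> s1S s2S.
have -> : walk (n + n) 1%g - walk (n.+1 + n.+1) 1%g =
   \sum_(s <- steps) \sum_(t <- steps) mu s * mu t * (walk (n + n) 1%g - walk (n + n) (s * t)%g).
  transitivity (\sum_(s <- steps) \sum_(t <- steps) (mu s * mu t) * walk (n + n) 1%g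
      - \sum_(s <- steps) \sum_(t <- steps) mu s * mu t * walk (n + n) (s * t)%g).
    congr (_ - _).
      under eq_bigr do rewrite -mulr_suml -mulr_sumr sum_steps mulr1.
      by rewrite -mulr_suml sum_steps mul1r.
    rewrite addSn addnS /=; apply: eq_bigr => s _.
    rewrite mulr_sumr; apply: eq_bigr => t _.
    by rewrite mulg1 mulrA -invgM walkV.
  rewrite -sumrB; apply: eq_bigr => s _; rewrite -sumrB; apply: eq_bigr => t _.
  by rewrite mulrBr.
have pos s t : 0 <= mu s * mu t * (walk (n + n) 1%g - walk (n + n) (s * t)%g).
  by rewrite !mulr_ge0 // subr_ge0 walk_le1.
rewrite (big_fsetD1 s1) //= (big_fsetD1 s2) //= -addrA lerDl addr_ge0 ?sumr_ge0 //.
by move=> s _; rewrite sumr_ge0.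
Qed.

(** * An invariant mean when the return probabilities decay slowly *)

Section Mean.
Hypothesis slow : forall lam : R, lam < 1 ->
  exists n, lam * walk (n + n) 1%g < walk (n.+1 + n.+1) 1%g.

Definition sqr_mean n (A : set G) : R :=
  fine (\esum_(g in A) (walk n g ^+ 2)%:E)%E / walk (n + n) 1%g.

Lemma sqr_fin n (A : set G) : (\esum_(g in A) (walk n g ^+ 2)%:E)%E \is a fin_num.
Proof.
rewrite ge0_fin_numE; last by apply: esum_ge0 => g _; rewrite lee_fin sqr_ge0.
apply: (@le_lt_trans _ _ (walk (n + n) 1%g)%:E); last by rewrite ltry.
rewrite -(esum_walk_sqr n 1%g) (_ : (\esum_(g in A) _)%E =
  (\esum_(g in A) (walk n (1^-1 * g)%g ^+ 2)%:E)%E).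
  by apply: subset_esum => // g; rewrite lee_fin sqr_ge0.
by apply: eq_esum => g _; rewrite invg1 mul1g.
Qed.

Lemma sqr_meanT n : sqr_mean n setT = 1.
Proof.
rewrite /sqr_mean (_ : (\esum_(g in _) _)%E =
  (\esum_(g in [set: G]) (walk n (1^-1 * g)%g ^+ 2)%:E)%E).
  by rewrite esum_walk_sqr /= divff // gt_eqF // walk_even_gt0.
by apply: eq_esum => g _; rewrite invg1 mul1g.
Qed.

Lemma sqr_mean_ge0 n A : 0 <= sqr_mean n A.
Proof.
rewrite divr_ge0 ?walk_ge0 // fine_ge0 //.
by apply: esum_ge0 => g _; rewrite lee_fin sqr_ge0.
Qed.

Lemma sqr_meanU n A B : A `&` B = set0 -> sqr_mean n (A `|` B) = sqr_mean n A + sqr_mean n B.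
Proof.
move=> AB; rewrite -mulrDl; congr (_ / _).
rewrite (esumID A) => [|g _]; last by rewrite lee_fin sqr_ge0.
have -> : (A `|` B) `&` A = A by rewrite setIC setIUr setIid AB setU0.
have -> : (A `|` B) `&` ~` A = B.
  by rewrite setIUl setICr set0U; apply/setIidPl/disjoints_subset; rewrite setIC.
by rewrite fineD ?sqr_fin.
Qed.

(** With [a = walk n g] and [b = walk n (t^-1 * g)], expanding
    [k * ((a - b) + eta * (a + b)) ^+ 2 >= 0] for [k = (2 * eta)^-1] bounds [b ^+ 2 - a ^+ 2] by [k
    * (a - b) ^+ 2 + eta / 2 * (a + b) ^+ 2]. The first sum is controlled by [walk_even_drop], the
    second by [4 * u]. *)
Lemma sqr_mean_shift n s1 s2 (eta : R) A : s1 \in steps -> s2 \in steps -> 0 < eta ->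
  sqr_mean n [set ((s1 * s2)^-1 * a)%g | a in A] <= sqr_mean n A + 2 * eta +
   (1 - walk (n.+1 + n.+1) 1%g / walk (n + n) 1%g) / (mu s1 * mu s2 * eta).
Proof.
move=> s1S s2S eta0; set t := (s1 * s2)%g.
pose k := (2 * eta)^-1; have k0 : 0 <= k by rewrite invr_ge0; lra.
have kE : k * eta = 2^-1 by rewrite /k invfM divfK ?gt_eqF.
pose u := walk (n + n) 1%g; have u0 : 0 < u := walk_even_gt0 n.
have esT : (\esum_(g in A) ((walk n g + walk n (t^-1 * g)%g) ^+ 2)%:E <= (4 * u)%:E)%E.
  apply: (@le_trans _ _ (\esum_(g in [set: G]) ((2 * walk n (1^-1 * g)%g ^+ 2)%:E +
     (2 * walk n (t^-1 * g)%g ^+ 2)%:E))%E).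
    apply: (le_trans (subset_esum _ (@subsetT _ _))) => [g|]; first by rewrite lee_fin sqr_ge0.
    apply: le_esum => g _; rewrite invg1 mul1g -EFinD lee_fin.
    by have := sqr_ge0 (walk n g - walk n (t^-1 * g)%g); lra.
  rewrite esumD => [|g _|g _]; rewrite ?lee_fin ?mulr_ge0 ?walk_ge0 //.
  rewrite !esumZl ?esum_walk_sqr // => [|g|g]; rewrite ?sqr_ge0 //.
  by rewrite -!EFinM -EFinD lee_fin; rewrite /u; lra.
have esD : (\esum_(g in A) ((walk n g - walk n (t^-1 * g)%g) ^+ 2)%:E <=
    (2 * (u - walk (n + n) t))%:E)%E.
  rewrite -esum_walk_diff; apply: subset_esum; last exact: subsetT.
  by move=> x; rewrite lee_fin sqr_ge0.
have key : (\esum_(g in A) (walk n (t^-1 * g)%g ^+ 2)%:E <=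
   \esum_(g in A) (walk n g ^+ 2)%:E + (k * (2 * (u - walk (n + n) t)))%:E
     + (eta / 2 * (4 * u))%:E)%E.
  apply: (@le_trans _ _ (\esum_(g in A) (((walk n g ^+ 2)%:E +
     (k * (walk n g - walk n (t^-1 * g)%g) ^+ 2)%:E)
     + (eta / 2 * (walk n g + walk n (t^-1 * g)%g) ^+ 2)%:E))%E).
    apply: le_esum => g _; rewrite -!EFinD lee_fin.
    set a := walk n g; set b := walk n _.
    have h := mulr_ge0 k0 (sqr_ge0 ((a - b) + eta * (a + b))).
    have e1 : k * eta * ((a - b) * (a + b)) = 2^-1 * ((a - b) * (a + b)) by rewrite kE.
    have e2 : k * eta * (eta * (a + b) ^+ 2) = 2^-1 * (eta * (a + b) ^+ 2) by rewrite kE.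
    lra.
  have p1 x : (0 <= (walk n x ^+ 2)%:E)%E by rewrite lee_fin sqr_ge0.
  have p2 x : (0 <= (k * (walk n x - walk n (t^-1 * x)%g) ^+ 2)%:E)%E.
    by rewrite lee_fin mulr_ge0 // sqr_ge0.
  have p3 x : (0 <= (eta / 2 * (walk n x + walk n (t^-1 * x)%g) ^+ 2)%:E)%E.
    by rewrite lee_fin mulr_ge0 ?sqr_ge0 // divr_ge0 // ltW.
  rewrite !esumD //; last by move=> x _; rewrite adde_ge0.
  rewrite !esumZl //; try by move=> x; rewrite sqr_ge0.
  2: by rewrite divr_ge0 // ltW.
  rewrite !EFinM; apply: leeD; last by apply: lee_wpmul2l => //; rewrite lee_fin divr_ge0 // ltW.
  by apply: leeD => //; apply: lee_wpmul2l => //; rewrite lee_fin.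
have img : (\esum_(g in [set (t^-1 * a)%g | a in A]) (walk n g ^+ 2)%:E =
    \esum_(g in A) (walk n (t^-1 * g)%g ^+ 2)%:E)%E.
  by rewrite esum_image // => x y _ _; exact: mulgI.
have m1 := stepsP _ s1S; have m2 := stepsP _ s2S; have mm := mulr_gt0 m1 m2.
have drop := walk_even_drop n s1S s2S; rewrite -/t -/u in drop.
rewrite /sqr_mean img -/u.
have f1 := sqr_fin n A.
have f2 : (\esum_(g in A) (walk n (t^-1 * g)%g ^+ 2)%:E)%E \is a fin_num.
  by rewrite -img sqr_fin.
rewrite -(fineK f1) -(fineK f2) -!EFinD lee_fin in key.
have k1 : k * (2 * (u - walk (n + n) t)) <= (u - walk (n.+1 + n.+1) 1%g) / (mu s1 * mu s2 * eta).
  rewrite ler_pdivlMr ?mulr_gt0 //.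
  have -> : k * (2 * (u - walk (n + n) t)) * (mu s1 * mu s2 * eta) =
     (k * eta) * 2 * (mu s1 * mu s2 * (u - walk (n + n) t)) by lra.
  by rewrite kE mulVf ?mul1r // pnatr_eq0.
rewrite ler_pdivrMr // (mulrDl _ _ u) (mulrDl _ _ u) divfK ?gt_eqF //.
rewrite [X in _ <= _ + X]mulrAC mulrBl mul1r divfK ?gt_eqF //; lra.
Qed.

Local Notation shift g A := [set (g * a)%g | a in A].

Lemma shiftM (g h : G) (A : set G) : shift g (shift h A) = shift (g * h)%g A.
Proof. by rewrite image_comp; apply: eq_imagel => a _ /=; rewrite mulgA. Qed.

Lemma shift1 (A : set G) : shift 1%g A = A.
Proof. by rewrite -[RHS]image_id; apply: eq_imagel => a _; rewrite mul1g. Qed.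

Lemma slow_means : exists m : nat -> set G -> R,
  [/\ forall k A, 0 <= m k A, forall k, m k setT = 1,
   forall k A B, A `&` B = set0 -> m k (A `|` B) = m k A + m k B &
   forall s1 s2 A e, s1 \in steps -> s2 \in steps -> 0 < e ->
     \forall k \near \oo, m k (shift (s1 * s2)%g A) <= m k A + e].
Proof.
have /choice[f Hf] : forall k : nat, exists n,
    (1 - k.+1%:R^-1) * walk (n + n) 1%g < walk (n.+1 + n.+1) 1%g.
  by move=> k; apply: slow; rewrite ltrBlDr ltrDl invr_gt0 ltr0n.
exists (fun k => sqr_mean (f k)); split.
- by move=> k A; exact: sqr_mean_ge0.
- by move=> k; exact: sqr_meanT.
- by move=> k A B; exact: sqr_meanU.
move=> s1 s2 A e s1S s2S e0.
have sV s : s \in steps -> s^-1%g \in steps by move=> /stepsP s0; apply/stepsP; rewrite muV.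
have m1 := stepsP _ s1S; have m2 := stepsP _ s2S; have mm := mulr_gt0 m1 m2.
have c0 : 0 < mu s1 * mu s2 * (e / 4) by rewrite mulr_gt0 // divr_gt0.
near=> k.
(* Applied to the inverse steps in reverse order, so that the inverse of their product is
   [s1 * s2]. *)
have := sqr_mean_shift (f k) (eta := e / 4) A (sV _ s2S) (sV _ s1S) ltac:(by rewrite divr_gt0).
rewrite !muV -invgM invgK (mulrC (mu s2)) => /le_trans; apply.
rewrite -addrA lerD2l.
suff : (1 - walk ((f k).+1 + (f k).+1) 1%g / walk (f k + f k) 1%g)
    / (mu s1 * mu s2 * (e / 4)) <= e / 2.
  by lra.
rewrite ler_pdivrMr //.
have h := Hf k; rewrite -ltr_pdivlMr ?walk_even_gt0 // in h.
have kk : k.+1%:R^-1 <= e / 2 * (mu s1 * mu s2 * (e / 4)).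
  rewrite -[leRHS]invrK lef_pV2 ?posrE ?ltr0n ?invr_gt0 ?mulr_gt0 ?divr_gt0 //.
  apply: le_trans (_ : k%:R <= _); last by rewrite ler_nat.
  near: k; exact: nbhs_infty_ger.
by apply: le_trans kk; rewrite lerBlDr -lerBlDl ltW.
Unshelve. all: by end_near.
Qed.

Lemma slow_amenable : amenable R G.
Proof.
have [mk [mk0 mk1 mkU mkS]] := slow_means.
have [U [UU subU]] := ultraFilterLemma (F := \oo) _.
have UP : ProperFilter U by exact: ultra_proper.
have UF : Filter U by exact: filter_filter.
have mk_le1 k A : mk k A <= 1.
  by rewrite -(mk1 k) -(setUv A) mkU ?setICr // lerDl.
(* [L a l] says that [l] is the limit of [a] along the ultrafilter [U]; limits of the means exist by
   compactness of [[0, 1]]. *)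
pose L (a : nat -> R) l := forall e, 0 < e -> U [set k | `|a k - l| < e].
have L_le a b l l' : L a l -> L b l' -> (forall e, 0 < e -> U [set k | a k <= b k + e]) -> l <= l'.
  move=> La Lb ab; apply/ler_addgt0Pr => e e0.
  have e3 : 0 < e / 3 by rewrite divr_gt0.
  have [k [/= [h1 h2] h3]] := filter_ex (filterI (filterI (La _ e3) (Lb _ e3)) (ab _ e3)).
  move: h1 h2; rewrite !ltr_norml => /andP[h1 h1'] /andP[h2 h2']; lra.
have L_eq a b l l' : L a l -> L b l' -> (forall e, 0 < e -> U [set k | a k <= b k + e]) ->
    (forall e, 0 < e -> U [set k | b k <= a k + e]) -> l = l'.
  by move=> La Lb h1 h2; apply/eqP; rewrite eq_le (L_le _ _ _ _ La Lb) // (L_le _ _ _ _ Lb La).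
have L_cst c : L (fun _ => c) c.
  by move=> e e0; apply: filterE => k /=; rewrite subrr normr0.
have L_add a b l l' : L a l -> L b l' -> L (fun k => a k + b k) (l + l').
  move=> La Lb e e0; have e2 : 0 < e / 2 by rewrite divr_gt0.
  apply: filterS (filterI (La _ e2) (Lb _ e2)) => k [/= h1 h2].
  move: h1 h2; rewrite !ltr_norml => /andP[h1 h1'] /andP[h2 h2']; apply/andP; split; lra.
have /choice[m mL] : forall A, exists l, L (mk ^~ A) l.
  move=> A.
  have [|l [_ clu]] := @segment_compact R 0 1 ((mk ^~ A) @ U) _ _.
    change (U [set k | `[0, 1]%classic (mk k A)]); apply: filterE => k /=.
    by rewrite in_itv /= mk0 mk_le1.
  exists l => e e0; have [//|nU] := in_ultra_setVsetC [set k | `|mk k A - l| < e] UU.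
  have [x [/= h1 h2]] := clu [set y : R | ~ `|y - l| < e] (ball l e) nU (nbhsx_ballx l e e0).
  by case: h1; rewrite distrC.
have [s0 s0S] := steps_ex.
have sV s : s \in steps -> s^-1%g \in steps by move=> /stepsP ?; apply/stepsP; rewrite muV.
have m_le s1 s2 A : s1 \in steps -> s2 \in steps -> m (shift (s1 * s2)%g A) <= m A.
  move=> s1S s2S; apply: L_le (mL _) (mL _) _ => e e0; exact/subU/mkS.
have m_inv s1 s2 A : s1 \in steps -> s2 \in steps -> m (shift (s1 * s2)%g A) = m A.
  move=> s1S s2S; apply/eqP; rewrite eq_le m_le //=.
  have := m_le s2^-1%g s1^-1%g (shift (s1 * s2)%g A) (sV _ s2S) (sV _ s1S).
  by rewrite shiftM -invgM mulVg shift1.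
have m_ge0 A : 0 <= m A.
  apply: L_le (L_cst 0) (mL A) _ => e e0; apply: filterE => k /=.
  by rewrite addr_ge0 // ltW.
have m_T : m setT = 1.
  by apply: L_eq (mL setT) (L_cst 1) _ _ => e e0; apply: filterE => k /=; rewrite mk1 lerDl ltW.
have mU A B : A `&` B = set0 -> m (A `|` B) = m A + m B.
  move=> AB; apply: L_eq (mL _) (L_add _ _ _ _ (mL A) (mL B)) _ _ => e e0;
    by apply: filterE => k /=; rewrite mkU // lerDl ltW.
(* The limit [m] is only invariant under products of two steps. Averaging it with its translate by
   one step [s0] gives invariance under every single step, because a step exchanges the two
   terms. *)
pose M A := (m A + m (shift s0 A)) / 2.
have M_step s A : s \in steps -> M (shift s A) = M A.
  move=> sS; rewrite /M shiftM m_inv // addrC; congr ((_ + _) / 2).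
  by rewrite -(m_inv s0 s^-1%g) ?sV // shiftM mulgVK.
exists M; split.
- by move=> A; rewrite /M divr_ge0 // addr_ge0.
- rewrite /M (_ : shift s0 setT = setT) ?m_T; first by rewrite -mulr2n -mulr_natl mulr1 divff.
  by apply/seteqP; split=> // g _; exists (s0^-1 * g)%g; rewrite ?mulVKg.
- move=> A B AB; rewrite /M image_setU !mU //; first by rewrite -mulrDl addrACA.
  apply/seteqP; split=> // _ [[a Aa <-] [b Bb /mulgI ba]].
  by have : (A `&` B) a by [split=> //; rewrite -ba]; rewrite AB.
- suff H : [set g | forall A, M (shift g A) = M A] = setT.
    by move=> g; have : [set: G] g by []; rewrite -H.
  case: adm => _ _ _; apply.
  + by move=> s sS A; apply: M_step; apply/stepsP.
  + by move=> A /=; rewrite shift1.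
  + by move=> x y /= Hx Hy A; rewrite -shiftM Hx Hy.
  + by move=> x /= Hx A; rewrite -Hx shiftM mulgV shift1.
Qed.
End Mean.

(** * The Green function *)

Implicit Types (x y z : G) (v w : seq G) (A B C : set (seq G)).

Local Notation d := (word_dist S).

Let Sinv s : S s -> S s^-1%g. Proof. by rewrite /msupport /= muV. Qed.
Let genS : generates S. Proof. by case: adm. Qed.

Definition weight_sum A : \bar R := (\esum_(w in A) (weight mu w)%:E)%E.

Lemma weight_ge0 w : 0 <= weight mu w.
Proof. exact: prodr_ge0. Qed.

Lemma weight_gt0 w : words S w -> 0 < weight mu w.
Proof. by move=> Sw; rewrite /weight big_seq; apply: prodr_gt0 => s /Sw. Qed.

Lemma weight_cat v w : weight mu (v ++ w) = weight mu v * weight mu w.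
Proof. exact: big_cat. Qed.

Lemma weight_inv w : weight mu (word_inv w) = weight mu w.
Proof.
rewrite /weight /word_inv big_map (perm_big w) /=; last by rewrite perm_rev.
by apply: eq_bigr => s _; rewrite muV.
Qed.

Lemma weight_sum_ge0 A : (0 <= weight_sum A)%E.
Proof. by apply: esum_ge0 => w _; rewrite lee_fin weight_ge0. Qed.

Lemma weight_sum_le A B : A `<=` B -> (weight_sum A <= weight_sum B)%E.
Proof. by apply: subset_esum => w; rewrite lee_fin weight_ge0. Qed.

Lemma weight_sum_bigcup (I : eqType) (r : seq I) A (B : I -> set (seq G)) :
  (forall w, A w -> exists2 i, i \in r & B i w) ->
  (weight_sum A <= \sum_(i <- r) weight_sum (B i))%E.
Proof. by apply: esum_seq_bigcup_le => w; rewrite lee_fin weight_ge0. Qed.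

Definition cat_set B C : set (seq G) := [set w | exists v1 v2, [/\ B v1, C v2 & w = v1 ++ v2]].

(** A choice of one decomposition for each word of [A] is an injection of [A] into [B * C]. *)
Lemma weight_sum_cat_le A B C (b c : R) : A `<=` cat_set B C ->
  (weight_sum B <= b%:E)%E -> (weight_sum C <= c%:E)%E -> (weight_sum A <= (b * c)%:E)%E.
Proof.
move=> ABC Bb Cc.
have /choice[f Hf] : forall w, exists p : seq G * seq G, A w -> [/\ B p.1, C p.2 & w = p.1 ++ p.2].
  move=> w; case: (pselect (A w)) => [/ABC[v1 [v2 H]]|nA]; first by exists (v1, v2).
  by exists ([::], [::]).
have Cfin : weight_sum C \is a fin_num.
  by rewrite ge0_fin_numE ?weight_sum_ge0 // (le_lt_trans Cc) ?ltry.
apply: (@le_trans _ _ (\esum_(p in B `*` C) (weight mu p.1 * weight mu p.2)%:E)%E).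
  apply: (esum_inj_le (f := f)).
  - move=> v w; rewrite !inE => /Hf[_ _ Ev] /Hf[_ _ Ew] fvw.
    by rewrite Ev Ew fvw.
  - by move=> w /Hf[].
  - by move=> w /Hf[_ _ Ew]; rewrite lee_fin -weight_cat -Ew.
  - by move=> p; rewrite lee_fin mulr_ge0 ?weight_ge0.
rewrite esum_mul //; try exact: weight_ge0.
rewrite EFinM; apply: lee_pmul => //; exact: weight_sum_ge0.
Qed.

Lemma weight_sum_cat_ge A B C :
  weight_sum C \is a fin_num ->
  (forall v1 v2, B v1 -> C v2 -> A (v1 ++ v2)) ->
  (forall v1 v2 w1 w2, B v1 -> C v2 -> B w1 -> C w2 -> v1 ++ v2 = w1 ++ w2 -> v1 = w1) ->
  (weight_sum B * weight_sum C <= weight_sum A)%E.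
Proof.
move=> Cfin BCA inj.
rewrite -esum_mul //; try exact: weight_ge0.
apply: (esum_inj_le (f := fun p : seq G * seq G => p.1 ++ p.2)).
- move=> [v1 v2] [w1 w2]; rewrite !inE => -[/= Bv Cv] [/= Bw Cw] E.
  have E1 := inj _ _ _ _ Bv Cv Bw Cw E; move: E; rewrite E1 => /eqP.
  by rewrite eqseq_cat // eqxx /= => /eqP ->.
- by move=> [v1 v2] [/= Bv Cv]; exact: BCA.
- by move=> [v1 v2] _ /=; rewrite weight_cat.
- by move=> w; rewrite lee_fin weight_ge0.
Qed.

Lemma weight_sum_walk n g :
  (weight_sum [set w | fiber S g w /\ size w = n] <= (walk n g)%:E)%E.
Proof.
elim: n g => [|n IH] g.
  have [->|g1] := eqVneq g 1%g.
    apply: (@le_trans _ _ (weight_sum [set [::]])).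
      by apply: weight_sum_le => w [_ /size0nil].
    rewrite /weight_sum esum_set1 ?lee_fin ?weight_ge0 //=.
    by rewrite /weight big_nil eqxx.
  rewrite /weight_sum esum1 ?lee_fin ?walk_ge0 // => w [[_ Ew] /size0nil w0].
  by move: g1; rewrite -Ew w0 word_eval_nil eqxx.
pose B s := cons s @` [set w | fiber S (s^-1 * g)%g w /\ size w = n].
apply: (le_trans (weight_sum_bigcup (r := steps) (B := B) _)).
  move=> [|s w] [[Sw Ew] sw] //; have [Ss Sw'] := (words_cons S s w).1 Sw.
  exists s; first exact/stepsP.
  by exists w => //; split; [split=> //; rewrite -Ew word_eval_cons mulKg|case: sw].
rewrite /= -sumEFin; apply: lee_sum => s _.
rewrite /B /weight_sum esum_image; last by move=> v w _ _ [].
apply: (@le_trans _ _ ((mu s)%:E *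
    weight_sum [set w | fiber S (s^-1 * g)%g w /\ size w = n])%E).
  rewrite -esumZl //; last exact: weight_ge0.
  by apply: le_esum => w _; rewrite /weight big_cons.
by rewrite EFinM lee_wpmul2l // lee_fin.
Qed.

(** The Green function is a supremum over finite sets of words. Lengths are bounded on such a set,
    and grouping by length compares its weight with a partial sum. *)
Lemma green_le_walk k g (C : R) : (forall w, fiber S g w -> (k <= size w)%N) ->
  (forall N, \sum_(k <= n < N) walk n g <= C) -> (green mu g <= C%:E)%E.
Proof.
move=> kg HC; apply: ge_ereal_sup => _ [X [finX XA] <-].
pose N := (\max_(w <- fset_set X) size w).+1.
rewrite -esum_fset // => [|w _]; last by rewrite lee_fin weight_ge0.
apply: (le_trans (weight_sum_bigcup (r := index_iota k N)
   (B := fun n => [set w | fiber S g w /\ size w = n]) _)).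
  move=> w Xw; exists (size w); last by split=> //; exact: XA.
  rewrite mem_index_iota kg /=; last exact: XA.
  by rewrite ltnS; apply: leq_bigmax_seq; rewrite ?in_fset_set ?inE.
apply: (@le_trans _ _ (\sum_(k <= n < N) (walk n g)%:E)%E).
  by apply: lee_sum => n _; exact: weight_sum_walk.
by rewrite sumEFin lee_fin.
Qed.

(** * Exponential decay and multiplicativity of the Green function *)

Hypothesis nonamenable_G : ~ amenable R G.

Lemma walk_decay : exists2 lam : R, 0 < lam < 1 & forall n g, walk n g <= lam ^+ n./2.
Proof.
have [lam lam1 H] : exists2 lam : R, lam < 1 &
    forall n, walk (n.+1 + n.+1) 1%g <= lam * walk (n + n) 1%g.
  apply: contrapT => no; apply: nonamenable_G; apply: slow_amenable => lam lam1.
  apply: contrapT => nn; apply: no; exists lam => // n; rewrite leNgt; apply/negP => h.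
  by apply: nn; exists n.
have lam0 : 0 < lam.
  have := H 0%N; have := walk_even_gt0 1.
  rewrite (_ : walk (0 + 0) 1%g = 1) ?mulr1; last by rewrite /= eqxx.
  exact: lt_le_trans.
have even n g : walk (n + n) g <= lam ^+ n.
  apply: le_trans (walk_le1 n g) _; elim: n {g} => [|n IH]; first by rewrite /= eqxx expr0.
  by apply: le_trans (H n) _; rewrite exprS ler_pM2l.
exists lam; first by rewrite lam0.
(* An odd time is an average over one step of the preceding even time. *)
move=> n g; rewrite -{1}(odd_double_half n) -addnn; case: (odd n) => /=; last exact: even.
rewrite -[leRHS]mul1r -sum_steps mulr_suml; apply: ler_sum => s _.
by rewrite ler_wpM2l ?even.
Qed.

Lemma green_decay : exists2 lam : R, 0 < lam < 1 & forall k g,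
  (forall w, fiber S g w -> (k <= size w)%N) ->
  (green mu g <= (2 / (1 - lam) * lam ^+ k./2)%:E)%E.
Proof.
have [lam /andP[lam0 lam1] H] := walk_decay; exists lam; first by rewrite lam0.
move=> k g kg; apply: green_le_walk kg _ => N.
have l1 : 0 < 1 - lam by rewrite subr_gt0.
(* [T n] is the tail from [n] of the series of [lam ^+ m./2], so the partial sums telescope. *)
pose T n := (lam ^+ n./2 + lam ^+ n.+1./2) / (1 - lam).
have Tn n : T n - T n.+1 = lam ^+ n./2.
  rewrite /T -mulrBl (_ : _ - _ = lam ^+ n./2 * (1 - lam)) ?mulfK ?gt_eqF //.
  by rewrite /= exprS; lra.
have T0 n : 0 <= T n by apply: divr_ge0; [rewrite addr_ge0 // exprn_ge0 // ltW|rewrite ltW].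
have Tk : T k <= 2 / (1 - lam) * lam ^+ k./2.
  rewrite /T mulrAC ler_pM2r ?invr_gt0 // mulr_natl mulr2n lerD2l.
  by apply: ler_wiXn2l; rewrite ?ltW ?half_leq.
apply: le_trans Tk; have [Nk|kN] := leqP N k; first by rewrite big_geq.
apply: (@le_trans _ _ (\sum_(k <= n < N) (T n - T n.+1))).
  by apply: ler_sum => n _; rewrite Tn.
rewrite -[leRHS]opprK; under eq_bigr do rewrite -opprB.
by rewrite sumrN telescope_sumr ?(ltnW kN) // lerN2 -subr_ge0 opprK subrK.
Qed.

Lemma green_fin g : green mu g \is a fin_num.
Proof.
have [lam _ /(_ 0%N g (fun _ _ => leq0n _)) H] := green_decay.
by rewrite ge0_fin_numE ?weight_sum_ge0 // (le_lt_trans H) ?ltry.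
Qed.

Definition gr g : R := fine (green mu g).

Lemma grE g : (gr g)%:E = green mu g.
Proof. by rewrite fineK ?green_fin. Qed.

Lemma weight_sum_fiber g : weight_sum (fiber S g) = (gr g)%:E.
Proof. by rewrite grE. Qed.

Lemma gr_far (c : R) : 0 < c -> exists k, forall g, (k <= word_norm S g)%N -> gr g < c.
Proof.
move=> c0; have [lam /andP[lam0 lam1] H] := green_decay.
have l1 : 0 < 1 - lam by rewrite subr_gt0.
pose e := c / (2 / (1 - lam)).
have e0 : 0 < e by rewrite !divr_gt0.
have [n Hn] : exists n, lam ^+ n < e.
  have : (fun n => lam ^+ n) @ \oo --> (0 : R).
    by apply: cvg_expr; rewrite gtr0_norm.
  move=> /cvgrPdist_lt /(_ e e0) [n _ /(_ n (leqnn n)) /=].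
  by rewrite sub0r normrN gtr0_norm ?exprn_gt0 //; exists n.
exists n.*2 => g ng; rewrite -lte_fin grE.
have kg w : fiber S g w -> (n.*2 <= size w)%N.
  by move=> Hw; apply: leq_trans ng _; exact: (word_norm_le Sinv genS Hw).
apply: le_lt_trans (H _ _ kg) _; rewrite lte_fin doubleK mulrC.
by rewrite -ltr_pdivlMr // divr_gt0.
Qed.

Lemma gr_ge_cat g h w : fiber S h w -> gr g * weight mu w <= gr (g * h)%g.
Proof.
move=> Hw; rewrite -lee_fin grE EFinM -weight_sum_fiber muleC -esumZl ?weight_ge0 //.
  apply: (esum_inj_le (f := fun v => v ++ w)).
  - move=> v1 v2 _ _ E; have := congr1 (fun u => take (size u - size w) u) E.
    by rewrite !size_cat !addnK !take_size_cat.
  - by move=> v Hv; exact: fiber_cat.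
  - by move=> v _; rewrite weight_cat mulrC.
  - by move=> v; rewrite lee_fin weight_ge0.
by move=> v; exact: weight_ge0.
Qed.

Lemma grV_le g : gr g <= gr g^-1%g.
Proof.
rewrite -lee_fin !grE; apply: (esum_inj_le (f := @word_inv G)).
- by move=> v w _ _; exact: (can_inj (@word_invK G)).
- by move=> w; exact: fiber_inv.
- by move=> w _; rewrite weight_inv.
- by move=> w; rewrite lee_fin weight_ge0.
Qed.

Lemma grV g : gr g^-1%g = gr g.
Proof. by apply/eqP; rewrite eq_le grV_le andbT -{2}(invgK g) grV_le. Qed.

Lemma gr_ge0 g : 0 <= gr g.
Proof. by rewrite fine_ge0 // weight_sum_ge0. Qed.

Lemma gr1_ge1 : 1 <= gr 1%g.
Proof.
rewrite -lee_fin grE; apply: (@le_trans _ _ (weight_sum [set [::]])).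
  by rewrite /weight_sum esum_set1 ?lee_fin ?weight_ge0 // /weight big_nil.
by apply: weight_sum_le => w ->; exact: fiber_nil.
Qed.

Lemma gr_gt0 g : 0 < gr g.
Proof.
have [w Hw] := fiber_ex Sinv genS g.
have := gr_ge_cat 1%g Hw; rewrite mul1g; apply: lt_le_trans.
by rewrite mulr_gt0 ?(lt_le_trans ltr01 gr1_ge1) //; apply: weight_gt0; case: Hw.
Qed.

(* Splitting a path at its first visit to [g]. *)
Lemma gr_mul_le g h : gr g * gr h <= gr 1%g * gr (g * h)%g.
Proof.
(* [F] consists of the paths that reach [g] only at their end. A word has at most one prefix in [F],
   so its weight [f] satisfies both [gr g <= f * gr 1] and [f * gr h <= gr (g * h)]. *)
pose F := [set w | fiber S g w /\ forall i, (i < size w)%N -> word_eval (take i w) <> g].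
have Ffin : weight_sum F \is a fin_num.
  rewrite ge0_fin_numE ?weight_sum_ge0 // (@le_lt_trans _ _ (weight_sum (fiber S g))) //.
    by apply: weight_sum_le => w [].
  by rewrite weight_sum_fiber ltry.
pose f := fine (weight_sum F); have fE : (f%:E)%E = weight_sum F by rewrite fineK.
have f0 : 0 <= f by rewrite fine_ge0 ?weight_sum_ge0.
have gf : gr g <= f * gr 1%g.
  rewrite -lee_fin grE; apply: (weight_sum_cat_le (B := F) (C := fiber S 1%g)).
  - move=> w [Sw Ew].
    have ex : exists i, (i <= size w)%N && (word_eval (take i w) == g).
      by exists (size w); rewrite leqnn take_size Ew eqxx.
    case: (ex_minnP ex) => i /andP[iw /eqP Ei] mini.
    exists (take i w), (drop i w); split; last by rewrite cat_take_drop.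
    + split; first by split=> //; exact: words_take.
      move=> j; rewrite size_takel // => ji E.
      move: E; rewrite take_takel; last exact: ltnW.
      move=> E.
      have := mini j; rewrite E eqxx (leq_trans (ltnW ji) iw) => /(_ isT).
      by rewrite leqNgt ji.
    + split; first exact: words_drop.
      have : word_eval (take i w ++ drop i w) = g by rewrite cat_take_drop.
      by rewrite word_eval_cat Ei => /(canRL (mulKg g)); rewrite mulVg.
  - by rewrite fE.
  - by rewrite weight_sum_fiber.
have fgh : f * gr h <= gr (g * h)%g.
  rewrite -lee_fin EFinM fE (grE (g * h)%g) -(weight_sum_fiber h).
  apply: weight_sum_cat_ge; first by rewrite weight_sum_fiber.
    by move=> v1 v2 [Hv1 _] Hv2; exact: fiber_cat.
  move=> v1 v2 w1 w2 [[_ Ev] Hv] _ [[_ Ew] Hw] _ E.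
  have [vw|wv|vw] := ltngtP (size v1) (size w1).
  - case: (Hw _ vw); rewrite -Ev; congr word_eval.
    by have := congr1 (take (size v1)) E; rewrite take_size_cat // take_cat vw => <-.
  - case: (Hv _ wv); rewrite -Ew; congr word_eval.
    by have := congr1 (take (size w1)) E; rewrite take_cat wv take_size_cat // => ->.
  - by move/eqP: E; rewrite eqseq_cat // => /andP[/eqP].
have g1 := gr_ge0 1%g; have := ler_wpM2r (gr_ge0 h) gf.
by move/le_trans; apply; rewrite mulrAC mulrC ler_wpM2l.
Qed.

(** * From the thick Ancona property to thin bigons *)

Local Hint Resolve gr_gt0 : core.
Let dC := word_distC Sinv genS.
Let dT := word_distT Sinv genS.

(** All factors are at most [1], so the product is a positive lower bound for each step
    probability. *)
Definition min_step : R := \prod_(s <- steps) mu s.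

Lemma step_le1 s : s \in steps -> mu s <= 1.
Proof.
by move=> sS; rewrite -sum_steps (big_fsetD1 s) //= lerDl sumr_ge0.
Qed.

Lemma min_step_gt0 : 0 < min_step.
Proof. by rewrite /min_step big_seq; apply: prodr_gt0 => s /stepsP. Qed.

Lemma min_step_le s : s \in steps -> min_step <= mu s.
Proof.
move=> sS; rewrite /min_step (big_fsetD1 s) //= ler_piMr // big_seq.
apply: Num.Theory.prodr_ile1 => t; rewrite in_fsetD1 => /andP[_ tS].
by rewrite mu0 step_le1.
Qed.

Lemma min_step_le1 : min_step <= 1.
Proof. by have [s sS] := steps_ex; apply: le_trans (min_step_le sS) (step_le1 sS). Qed.

Lemma weight_ge k w : words S w -> (size w <= k)%N -> min_step ^+ k <= weight mu w.
Proof.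
have m0 := ltW min_step_gt0.
elim: w k => [|s w IH] [|k] //= Sw kw.
- by rewrite /weight big_nil expr0.
- by rewrite /weight big_nil exprn_ile1 // min_step_le1.
- have [Ss Sw'] := (words_cons S s w).1 Sw.
  rewrite /weight big_cons exprS; apply: ler_pM; rewrite ?exprn_ge0 //.
    by apply: min_step_le; apply/stepsP.
  exact: IH.
Qed.

(** Harnack inequality: append to every path a fixed shortest word for [h], whose weight is at least
    [min_step ^+ k]. *)
Lemma gr_harnackr k g h : (word_norm S h <= k)%N -> gr g * min_step ^+ k <= gr (g * h)%g.
Proof.
have [w Hw <-] := word_norm_ex Sinv genS h => kw.
apply: le_trans (gr_ge_cat g Hw).
by rewrite ler_pM2l // weight_ge //; case: Hw.
Qed.

Lemma gr_harnackl k g h : (word_norm S h <= k)%N -> gr g * min_step ^+ k <= gr (h * g)%g.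
Proof.
by move=> hk; rewrite -(grV g) -(grV (h * g)%g) invgM; apply: gr_harnackr; rewrite word_normV.
Qed.

Lemma gr_harnack k x y (u v : G) : (d x u <= k)%N -> (d y v <= k)%N ->
  gr (u^-1 * v)%g * min_step ^+ (k + k) <= gr (x^-1 * y)%g.
Proof.
move=> xu yv; rewrite exprD mulrA.
have h1 := @gr_harnackl k (u^-1 * v)%g (x^-1 * u)%g xu.
have := @gr_harnackr k (x^-1 * v)%g (v^-1 * y)%g; rewrite -/(d v y) dC => /(_ yv).
rewrite mulgA mulgK; apply: le_trans; rewrite ler_pM2r ?exprn_gt0 ?min_step_gt0 //.
by move: h1; rewrite mulgA mulgK.
Qed.

(** Only the length of this list enters the constants, so repetitions are harmless. *)
Fixpoint ball_seq k : seq G :=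
  if k is k'.+1 then 1%g :: [seq (s * g)%g | s <- steps, g <- ball_seq k'] else [:: 1%g].

Lemma mem_ball_seq k g : (word_norm S g <= k)%N -> g \in ball_seq k.
Proof.
have [w [Sw <-] <-] := word_norm_ex Sinv genS g.
elim: w Sw k => [|s w IH] Sw k.
  by rewrite word_eval_nil; case: k => [|k] /=; rewrite inE eqxx.
case: k => // k /= kw; rewrite word_eval_cons inE; apply/orP; right.
have [Ss Sw'] := (words_cons S s w).1 Sw.
by apply: allpairs_f; [apply/stepsP|apply: IH].
Qed.

Definition passes x y k w : Prop :=
  exists2 i, (i <= size w)%N & (d y (x * word_eval (take i w))%g <= k)%N.

Definition avoiding x y z k : set (seq G) :=
  [set w | fiber S (x^-1 * z)%g w /\ ~ passes x y k w].

Lemma thick_anconaE eps r k x y z : r <= k%:R -> thick_ancona mu eps r ->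
  word_interval S x z y -> (weight_sum (avoiding x y z k) <= (eps * gr (x^-1 * z)%g)%:E)%E.
Proof.
move=> rk TA xyz; have := TA x z y xyz; rewrite /path_prob.
set E := [set w | _ !=set0]; set P := word_paths S x z; rewrite -/(gr _); set g := gr _ => H.
have g0 : 0 < g := gr_gt0 _.
have PE : weight_sum (P `&` E) \is a fin_num.
  rewrite ge0_fin_numE ?weight_sum_ge0 // (@le_lt_trans _ _ (weight_sum P)) //.
    by apply: weight_sum_le => // w [].
  by rewrite weight_sum_fiber ltry.
have {}H : (((1 - eps) * g)%:E <= weight_sum (P `&` E))%E.
  move: H; under eq_esum do rewrite mulrC.
  rewrite esumZl; [|by rewrite invr_ge0 ltW|by move=> w; exact: weight_ge0].
  rewrite [X in (_ * X)%E](_ : _ = weight_sum (P `&` E)) // -(fineK PE) -EFinM !lee_fin mulrC.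
  by rewrite ler_pdivlMr.
have sub : avoiding x y z k `<=` P `&` ~` E.
  move=> w [Pw np]; split=> // -[u [/= ru [i iw Eu]]]; apply: np; exists i => //.
  by rewrite -Eu -(ler_nat R); apply: le_trans ru rk.
apply: (le_trans (weight_sum_le sub)).
have := weight_sum_fiber (x^-1 * z)%g.
rewrite -/g {1}/weight_sum (esumID E) => [|w _]; last by rewrite lee_fin weight_ge0.
rewrite -!/(weight_sum _) -/P => Eg.
rewrite -(@leeD2lE _ (weight_sum (P `&` E)) _ _ PE) Eg -(fineK PE) -EFinD lee_fin.
by move: H; rewrite -(fineK PE) lee_fin; lra.
Qed.

(** Append to each path a fixed word of at most one letter from [z] to [z']. The added vertex can be
    closer to [y] by one, hence [k.+1]. One factor [min_step] pays for this word, the other for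
    comparing the two Green functions. *)
Lemma avoiding_near x y z z' k (c : R) : (d z z' <= 1)%N ->
  (weight_sum (avoiding x y z' k) <= (c * gr (x^-1 * z')%g)%:E)%E -> 0 <= c ->
  (weight_sum (avoiding x y z k.+1) <= (c / min_step ^+ 2 * gr (x^-1 * z)%g)%:E)%E.
Proof.
move=> zz' H c0; have m0 := min_step_gt0.
have [v Hv vd] := word_norm_ex Sinv genS (z^-1 * z')%g.
have sv : (size v <= 1)%N by rewrite vd.
have wv : min_step <= weight mu v by rewrite -[leLHS]expr1 weight_ge //; case: Hv.
have wv0 : 0 < weight mu v := lt_le_trans m0 wv.
have fin : weight_sum (avoiding x y z k.+1) \is a fin_num.
  rewrite ge0_fin_numE ?weight_sum_ge0 // (@le_lt_trans _ _ (weight_sum (fiber S (x^-1 * z)%g))) //.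
    by apply: weight_sum_le => // w [].
  by rewrite weight_sum_fiber ltry.
have H1 : ((weight mu v)%:E * weight_sum (avoiding x y z k.+1) <=
    weight_sum (avoiding x y z' k))%E.
  rewrite -esumZl; [|exact: ltW|by move=> w; exact: weight_ge0].
  apply: (esum_inj_le (f := fun w => w ++ v)).
  - move=> v1 v2 _ _ E; have := congr1 (fun u => take (size u - size v) u) E.
    by rewrite !size_cat !addnK !take_size_cat.
  - move=> w [Hw np]; split.
      by have := fiber_cat Hw Hv; rewrite mulgA mulgK.
    move=> [i]; rewrite size_cat => iw; rewrite take_cat; case: ltnP => wi dk; apply: np.
      by exists i; [exact: ltnW|exact: leqW].
    exists (size w) => //; rewrite take_size.
    have := dT y (x * word_eval (w ++ take (i - size w) v))%g (x * word_eval w)%g.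
    have : (d (x * word_eval (w ++ take (i - size w) v)) (x * word_eval w) <= 1)%N.
      have Swv : words S (w ++ v) by apply/words_cat; split; [case: Hw|case: Hv].
      have := @word_path_dist _ _ Sinv genS x (w ++ v) (size w) i Swv.
      rewrite size_cat wi iw take_size_cat // take_cat ltnNge wi /= => /(_ isT).
      by rewrite dC; lia.
    by move=> h1 h2; apply: leq_trans h2 _; rewrite -addn1; exact: leq_add.
  - by move=> w _; rewrite weight_cat mulrC.
  - by move=> w; rewrite lee_fin weight_ge0.
have H2 : gr (x^-1 * z')%g * min_step <= gr (x^-1 * z)%g.
  have := @gr_harnackr 1 (x^-1 * z')%g (z'^-1 * z)%g; rewrite -/(d z' z) dC expr1 => /(_ zz').
  by rewrite mulgA mulgK.
have := le_trans H1 H; rewrite -(fineK fin) -EFinM !lee_fin.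
set W := fine _ => h.
have W0 : 0 <= W by rewrite fine_ge0 // weight_sum_ge0.
have h1 : min_step * W <= c * gr (x^-1 * z')%g by apply: le_trans h; rewrite ler_wpM2r.
rewrite mulrAC ler_pdivlMr ?exprn_gt0 // expr2 mulrA.
apply: (@le_trans _ _ (c * gr (x^-1 * z')%g * min_step)).
  by rewrite ler_pM2r // mulrC.
by rewrite -mulrA ler_wpM2l.
Qed.

(** For either order of the visits, cut the path at a vertex [u] near [y] and a vertex [u'] near
    [y'], and sum over all such pairs. The Harnack inequality replaces [u], [u'] by [y], [y'] in
    three Green functions, each at the cost of [min_step ^+ (2 * k)]. *)
Lemma passing_both x y y' z k :
  (weight_sum [set w | [/\ fiber S (x^-1 * z)%g w, passes x y k w & passes x y' k w]] <=
  ((size (ball_seq k) ^ 2)%:R * (min_step ^+ (6 * k))^-1 * (gr (y^-1 * y')%g *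
    (gr (x^-1 * y)%g * gr (y'^-1 * z)%g + gr (x^-1 * y')%g * gr (y^-1 * z)%g)))%:E)%E.
Proof.
set N := size _; have m0 := min_step_gt0.
have d0 a : d a a = 0%N := word_dist_xx Sinv genS a.
pose V y y' := [set w | fiber S (x^-1 * z)%g w /\ exists i j, [/\ (i <= j <= size w)%N,
  (d y (x * word_eval (take i w))%g <= k)%N & (d y' (x * word_eval (take j w))%g <= k)%N]].
have bound a a' : (weight_sum (V a a') <= ((N ^ 2)%:R * (min_step ^+ (6 * k))^-1 *
    (gr (x^-1 * a)%g * gr (a^-1 * a')%g * gr (a'^-1 * z)%g))%:E)%E.
  pose r : seq (G * G) := [seq p <- [seq (g, h) | g <- ball_seq k, h <- ball_seq k] |
    (word_norm S p.1 <= k)%N && (word_norm S p.2 <= k)%N].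
  pose B (p : G * G) := cat_set (fiber S (x^-1 * (a * p.1))%g)
    (cat_set (fiber S ((a * p.1)^-1 * (a' * p.2))%g) (fiber S ((a' * p.2)^-1 * z)%g)).
  apply: (le_trans (weight_sum_bigcup (r := r) (B := B) _)).
    move=> w [[Sw Ew] [i [j [/andP[ij jw] di dj]]]].
    set u := (x * word_eval (take i w))%g in di.
    set u' := (x * word_eval (take j w))%g in dj.
    exists (a^-1 * u, a'^-1 * u')%g.
      by rewrite mem_filter /= di dj allpairs_f //; exact: mem_ball_seq.
    rewrite /B /= !mulVKg.
    exists (take i w), (drop i w); split; last by rewrite cat_take_drop.
      by split; [exact: words_take|rewrite /u mulKg].
    exists (take (j - i) (drop i w)), (drop j w); split.
    - split; first by apply: words_take; apply: words_drop.
      have tj : take j w = take i w ++ take (j - i) (drop i w) by rewrite -takeD subnKC.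
      by rewrite /u /u' tj word_eval_cat (mulgA x) mulKg.
    - split; first exact: words_drop.
      have : z = (x * word_eval w)%g by rewrite Ew mulVKg.
      by move=> ->; rewrite /u' -{3}(cat_take_drop j w) word_eval_cat (mulgA x) mulKg.
    - by rewrite -[in drop j w](subnK ij) -drop_drop cat_take_drop.
  apply: (@le_trans _ _ (\sum_(p <- r) ((min_step ^+ (6 * k))^-1 *
    (gr (x^-1 * a)%g * gr (a^-1 * a')%g * gr (a'^-1 * z)%g))%:E)%E).
    rewrite big_seq [leRHS]big_seq; apply: lee_sum => p.
    rewrite mem_filter => /andP[/andP[p1 p2] _].
    set u := (a * p.1)%g; set u' := (a' * p.2)%g.
    have du : (d a u <= k)%N by rewrite /word_dist mulKg.
    have du' : (d a' u' <= k)%N by rewrite /word_dist mulKg.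
    apply: (@le_trans _ _ (gr (x^-1 * u)%g * (gr (u^-1 * u')%g * gr (u'^-1 * z)%g))%:E).
      apply: (weight_sum_cat_le (A := B p) (B := fiber S (x^-1 * u)%g)
        (C := cat_set (fiber S (u^-1 * u')%g) (fiber S (u'^-1 * z)%g))) => //.
        by rewrite weight_sum_fiber.
      apply: (weight_sum_cat_le (B := fiber S (u^-1 * u')%g)
        (C := fiber S (u'^-1 * z)%g)) => //;
        by rewrite weight_sum_fiber.
    have k0 b : (d b b <= k)%N by rewrite d0.
    have e1 := gr_harnack (k0 x) du; have e2 := gr_harnack du du'.
    have e3 := gr_harnack du' (k0 z).
    rewrite lee_fin [leRHS]mulrC ler_pdivlMr ?exprn_gt0 //.
    have -> : (6 * k = (k + k) + (k + k) + (k + k))%N by lia.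
    rewrite !exprD -!exprD.
    have m1 := exprn_ge0 (k + k) (ltW m0).
    have gg b c := ltW (gr_gt0 (b^-1 * c)%g).
    have := ler_pM _ _ (ler_pM _ _ e1 e2) e3; rewrite !mulr_ge0 // => /(_ isT isT isT isT).
    by apply: le_trans; rewrite le_eqVlt; apply/orP; left; apply/eqP; rewrite !exprD; lra.
  rewrite sumEFin lee_fin big_const_seq count_predT iter_addr_0 -[leRHS]mulrA -[leLHS]mulr_natl.
  apply: ler_wpM2r; last rewrite ler_nat.
    by rewrite !mulr_ge0 ?invr_ge0 ?exprn_ge0 // ltW.
  by rewrite size_filter (leq_trans (count_size _ _)) // size_allpairs.
apply: (@le_trans _ _ (weight_sum (V y y') + weight_sum (V y' y))%E).
  have -> : (weight_sum (V y y') + weight_sum (V y' y) =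
     \sum_(b <- [:: true; false]) weight_sum (if b then V y y' else V y' y))%E.
    by rewrite !big_cons big_nil adde0.
  apply: weight_sum_bigcup => // w [Hw [i iw yi] [j jw yj]].
  have [ij|ji] := leqP i j; [exists true|exists false] => //; split=> //.
    by exists i, j; rewrite ij jw.
  by exists j, i; rewrite (ltnW ji) iw.
apply: (le_trans (leeD (bound _ _) (bound _ _))).
rewrite -EFinD lee_fin -mulrDr; apply: ler_wpM2l.
  by rewrite mulr_ge0 // invr_ge0 exprn_ge0 // ltW.
by rewrite -(grV (y'^-1 * y)%g) invgM invgK; lra.
Qed.

(** The paths avoiding [y] weigh at most [eps * g], those avoiding [y'] at most
    [eps / min_step ^+ 2 * g]; each bound is at most [g / 4], so half of the weight is left to
    [passing_both]. *)
Lemma gr_split eps r k x y y' z z' : 0 < eps < min_step ^+ 2 / 4 -> r <= k%:R ->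
  thick_ancona mu eps r -> (d z z' <= 1)%N ->
  word_interval S x z y -> word_interval S x z' y' ->
  gr (x^-1 * z)%g <= 2 * ((size (ball_seq k.+1) ^ 2)%:R * (min_step ^+ (6 * k.+1))^-1 *
    (gr (y^-1 * y')%g *
    (gr (x^-1 * y)%g * gr (y'^-1 * z)%g + gr (x^-1 * y')%g * gr (y^-1 * z)%g))).
Proof.
move=> /andP[e0 e1] rk TA zz' xyz xyz'; have m0 := min_step_gt0; have m1 := min_step_le1.
have rk1 : r <= k.+1%:R by apply: le_trans rk _; rewrite ler_nat.
have a1 := thick_anconaE rk1 TA xyz.
have a2 := avoiding_near zz' (thick_anconaE rk TA xyz') (ltW e0).
have a3 := passing_both x y y' z k.+1.
pose B i := match i with
  | 0%N => avoiding x y z k.+1 | 1%N => avoiding x y' z k.+1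
  | _ => [set w | [/\ fiber S (x^-1 * z)%g w, passes x y k.+1 w & passes x y' k.+1 w]] end.
have cover : (weight_sum (fiber S (x^-1 * z)%g) <= \sum_(i <- [:: 0; 1; 2]%N) weight_sum (B i))%E.
  apply: weight_sum_bigcup => // w Hw.
  have [yw|nyw] := pselect (passes x y k.+1 w); last by exists 0%N.
  by have [yw'|nyw'] := pselect (passes x y' k.+1 w); [exists 2%N|exists 1%N].
move: cover; rewrite weight_sum_fiber !big_cons big_nil adde0 /B => cover.
move: (le_trans cover (leeD a1 (leeD a2 a3))); rewrite -!EFinD lee_fin.
set g := gr (x^-1 * z)%g; set Q := (_ * _ * (_ * (_ + _))).
have g0 : 0 < g := gr_gt0 _.
have h1 : eps * g <= g / 4.
  rewrite mulrC ler_pM2l // (le_trans (ltW e1)) // -[leRHS]mul1r ler_pM2r ?invr_gt0 //.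
  by rewrite exprn_ile1 // ltW.
have h2 : eps / min_step ^+ 2 * g <= g / 4.
  rewrite mulrC ler_pM2l // ler_pdivrMr ?exprn_gt0 // mulrC.
  by have := ltW e1; lra.
by lra.
Qed.

Lemma ancona_thin eps r : 0 < eps < min_step ^+ 2 / 4 -> 0 <= r -> thick_ancona mu eps r ->
  exists D, forall x z z' y y', (d z z' <= 1)%N -> between d x y z -> between d x y' z' ->
    d x y = d x y' -> (d y y' <= D)%N.
Proof.
move=> epsm r0 TA; have m0 := min_step_gt0; have m1 := min_step_le1.
pose k := Num.bound r; have rk : r <= k%:R by apply/ltW/archi_boundP.
pose C1 : R := (size (ball_seq k.+1) ^ 2)%:R * (min_step ^+ (6 * k.+1))^-1.
have C10 : 0 < C1 by rewrite mulr_gt0 ?invr_gt0 ?exprn_gt0 // ltr0n expn_gt0 orbF.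
have e0 : 0 < gr 1%g := gr_gt0 _.
(* The lower bound for [gr (y^-1 * c j)] obtained from [gr_split] once
   [min_step ^+ 2 * (a * bj j + aj j * b)] is at most [2 * gr 1 * g0]. *)
pose c0 := min_step ^+ 2 / (4 * C1 * gr 1%g).
have c00 : 0 < c0 by apply: divr_gt0; [exact: exprn_gt0|rewrite mulr_gt0 // mulr_gt0].
have [K HK] := gr_far c00.
exists (K + K)%N => x z z' y y' zz' byz byz' yy'.
have [w1 [Sw1 Ew1] sw1] := word_norm_ex Sinv genS (x^-1 * y')%g.
have [w2 [Sw2 Ew2] sw2] := word_norm_ex Sinv genS (y'^-1 * z')%g.
pose w := w1 ++ w2.
have Sw : words S w by apply/words_cat.
have Ew : (x * word_eval w)%g = z' by rewrite word_eval_cat Ew1 Ew2 mulgA !mulVKg.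
have sw : size w = d x z' by rewrite size_cat sw1 sw2.
pose c i := (x * word_eval (take i w))%g.
have c0x : c 0%N = x by rewrite /c take0 word_eval_nil mulg1.
have cn : c (size w) = z' by rewrite /c take_size.
have cy' : c (d x y') = y' by rewrite /c /d -sw1 take_size_cat // Ew1 mulVKg.
have gc i j : (i <= j <= size w)%N -> d (c i) (c j) = (j - i)%N.
  by apply: word_path_geod => //; rewrite Ew.
have cb i : (i <= size w)%N -> word_interval S x z' (c i).
  move=> iw; have := @geod_between _ d (size w) c 0 i (size w) gc iw (leqnn _).
  by rewrite c0x cn.
pose a := gr (x^-1 * y)%g; pose b := gr (y^-1 * z)%g.
pose aj i := gr (x^-1 * c i)%g; pose bj i := gr ((c i)^-1 * z)%g.
pose g0 := gr (x^-1 * z)%g.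
have a0 : 0 < a := gr_gt0 _; have b0 : 0 < b := gr_gt0 _.
have aj0 i : 0 < aj i := gr_gt0 _; have bj0 i : 0 < bj i := gr_gt0 _.
have g00 : 0 < g0 := gr_gt0 _.
have tri (u v t : G) : gr (u^-1 * v)%g * gr (v^-1 * t)%g <= gr 1%g * gr (u^-1 * t)%g.
  by have := gr_mul_le (u^-1 * v)%g (v^-1 * t)%g; rewrite mulgA mulgK.
have sym (u v : G) : gr (u^-1 * v)%g = gr (v^-1 * u)%g by rewrite -grV invgM invgK.
have near1 (u v t : G) : (d v t <= 1)%N -> gr (u^-1 * v)%g * min_step <= gr (u^-1 * t)%g.
  by move=> vt; have := @gr_harnackr 1 (u^-1 * v)%g (v^-1 * t)%g vt; rewrite mulgA mulgK expr1.
(* [Q i] says that [aj i / bj i] is at most [min_step ^- 2] times [a / b]. It holds at the end of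
   the geodesic, and at its first index the ratio is still at least [a / b], because one step
   changes it by a factor of at most [min_step ^- 2]. *)
pose Q i := (i <= size w)%N && (aj i * b * min_step ^+ 2 <= a * bj i).
have exQ : exists i, Q i.
  exists (size w); rewrite /Q leqnn /= /aj /bj cn.
  have h1 : gr (x^-1 * z')%g * min_step <= g0 by apply: near1; rewrite dC.
  have h2 : gr 1%g * min_step <= gr (z'^-1 * z)%g.
    by have := @near1 z z z' zz'; rewrite mulVg sym.
  have h3 : g0 * b <= gr 1%g * a by have := tri x z y; rewrite (sym z y).
  apply: (@le_trans _ _ (g0 * b * min_step)).
    by rewrite expr2 mulrA ler_pM2r // mulrAC ler_pM2r.
  apply: (@le_trans _ _ (gr 1%g * a * min_step)); first by rewrite ler_pM2r.
  by rewrite mulrAC mulrC ler_pM2l.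
case: (ex_minnP exQ) => j /andP[jw Qj] minj.
have Pj : a * bj j <= aj j * b.
  case: j jw Qj minj => [|j] jw Qj minj.
    rewrite /aj /bj c0x mulVg; have := tri y x z; rewrite (sym y x); exact.
  have nQ : a * bj j < aj j * b * min_step ^+ 2.
    rewrite ltNge; apply/negP => h; suff : (j.+1 <= j)%N by rewrite ltnn.
    by apply: minj; rewrite /Q h ltnW.
  have dj : (d (c j) (c j.+1) <= 1)%N by rewrite gc ?leqnSn ?jw // subSnn.
  have h1 : aj j * min_step <= aj j.+1 by apply: near1.
  have h2 : bj j.+1 * min_step <= bj j.
    by rewrite /bj !(sym _ z); apply: near1; rewrite dC.
  rewrite -(ler_pM2r m0); apply: (@le_trans _ _ (a * bj j)).
    by rewrite -mulrA ler_pM2l.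
  apply: (le_trans (ltW nQ)).
  by rewrite expr2 mulrA ler_pM2r // mulrAC ler_pM2r.
have ab : a * b <= gr 1%g * g0 := tri x y z.
have abj : aj j * bj j <= gr 1%g * g0 := tri x (c j) z.
(* The square of [a * bj j] is at most [(a * bj j) * (aj j * b) = (a * b) * (aj j * bj j)], and both
   factors on the right are at most [gr 1 * g0]. *)
have P1 : a * bj j <= gr 1%g * g0.
  have p1 : 0 <= a * bj j by rewrite ltW // mulr_gt0.
  have p2 : 0 <= gr 1%g * g0 by rewrite ltW // mulr_gt0.
  rewrite -ler_sqr ?nnegrE //.
  apply: (@le_trans _ _ ((a * bj j) * (aj j * b))).
    by rewrite expr2 ler_pM2l // mulr_gt0.
  rewrite expr2 (_ : _ * _ * _ = (a * b) * (aj j * bj j)); last by lra.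
  by apply: ler_pM; rewrite // mulr_ge0 // ltW.
have key := gr_split epsm rk TA zz' byz (cb j jw).
rewrite -/C1 -/a -/b -/g0 -/(aj j) -/(bj j) in key.
have grj : c0 <= gr (y^-1 * c j)%g.
  set gj := gr _ in key *; have gj0 : 0 < gj := gr_gt0 _.
  have h : min_step ^+ 2 * (a * bj j + aj j * b) <= 2 * (gr 1%g * g0).
    have : min_step ^+ 2 * (a * bj j) <= a * bj j.
      by apply: ler_piMl; [rewrite ltW // mulr_gt0|rewrite exprn_ile1 // ltW].
    rewrite mulrDr (mulrC (min_step ^+ 2) (aj j * b)); lra.
  rewrite /c0 ler_pdivrMr; last by rewrite mulr_gt0 // mulr_gt0.
  rewrite -(ler_pM2r g00).
  have h' : 2 * (C1 * gj) * (min_step ^+ 2 * (a * bj j + aj j * b)) <=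
    2 * (C1 * gj) * (2 * (gr 1%g * g0)) by rewrite ler_pM2l // mulr_gt0 // mulr_gt0.
  have key' : min_step ^+ 2 * g0 <= min_step ^+ 2 * (2 * (C1 * (gj * (a * bj j + aj j * b)))).
    by rewrite ler_pM2l ?exprn_gt0.
  lra.
have djK : (d y (c j) <= K)%N.
  rewrite leqNgt; apply/negP => h; have := HK (y^-1 * c j)%g (ltnW h).
  by rewrite ltNge grj.
have h1 := dT x y (c j); have h2 := dT x (c j) y.
have h3 : d x (c j) = j by rewrite -{1}c0x gc ?subn0 // jw.
have dn : (d x y' <= size w)%N by rewrite sw -byz' leq_addr.
(* Both points lie on the geodesic [c], so their distance is the difference of their levels; [y']
   has the level of [y], which is within [K] of that of [c j]. *)
have h4 : (d (c j) y' <= K)%N.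
  rewrite -[in X in (X <= _)%N]cy'; have [jd|dj] := leqP j (d x y').
    rewrite gc ?jd // leq_subLR -yy'; apply: (leq_trans h2).
    by rewrite h3 leq_add2l dC.
  rewrite dC gc ?(ltnW dj) // leq_subLR -yy' -[leqLHS]h3; apply: (leq_trans h1).
  by rewrite leq_add2l.
exact: leq_trans (dT y (c j) y') (leq_add djK h4).
Qed.

Lemma ancona_hyperbolic eps r : 0 < eps < min_step ^+ 2 / 4 -> 0 <= r -> thick_ancona mu eps r ->
  hyperbolic_group R G.
Proof.
move=> epsm r0 TA; have [D0 thin] := ancona_thin epsm r0 TA.
have geo x y : exists2 c, geod d (d x y) c & c 0%N = x /\ c (d x y) = y.
  have [w [Sw Ew] sw] := word_norm_ex Sinv genS (x^-1 * y)%g.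
  have E : (x * word_eval w)%g = y by rewrite Ew mulVKg.
  exists (fun i => x * word_eval (take i w))%g.
    by move=> i j; rewrite /word_dist -sw => ij; apply: word_path_geod => //; rewrite E.
  by split; rewrite ?take0 ?word_eval_nil ?mulg1 // /word_dist -sw take_size.
have [D HD] := thin_four_point (word_dist_xx Sinv genS) dC dT geo thin.
exists S; split => //.
(* Gromov products are half-sums of distances, so the four-point constant is halved. *)
exists (D%:R / 2); first by rewrite divr_ge0.
move=> o x y z; rewrite /gromov_product.
have := HD o x y z; rewrite -(ler_nat R) natrD natrD natr_max !natrD.
rewrite maxElt minElt; case: ltP => h1; case: ltP => h2 h; lra.
Qed.

End Walk.

Theorem theorem3 (R : realType) (G : groupType) (mu : G -> R)
    (nonamenable_G : ~ amenable R G) (admissible_mu : admissible mu) :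
  exists2 eps0 : R, 0 < eps0 &
    forall eps r : R, 0 < eps < eps0 -> 0 <= r ->
      thick_ancona mu eps r -> hyperbolic_group R G.
Proof.
exists (min_step mu ^+ 2 / 4).
  by apply: divr_gt0 => //; apply: exprn_gt0; exact: min_step_gt0.
by move=> eps r; exact: ancona_hyperbolic.
Qed.
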